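(* Let $\lambda\le\omega_1^{\mathrm{ck}}$ be a limit ordinal. A computable structure $\mathcal A$ has Scott rank $\lambda$ if and only if $\mathcal A$ has computably defined Scott rank $\lambda$. Furthermore, if $\lambda$ is computable (i.e. $\lambda<\omega_1^{\mathrm{ck}}$), then a computable structure $\mathcal A$ has Scott rank $\lambda+1$ if and only if it has computably defined Scott rank $\lambda+1$. Finally, a computable structure has Scott rank $1$ if and only if it has computably defined Scott rank $1$.
   Context: Structures are countable structures in a computable vocabulary. $\omega_1^{\mathrm{ck}}$ is the least non-computable ordinal. $\Sigma^{\mathrm{in}}_\alpha$ and $\Pi^{\mathrm{in}}_\alpha$ denote the usual classes of infinitary $L_{\omega_1\omega}$ formulas ($\Sigma^{\mathrm{in}}_0=\Pi^{\mathrm{in}}_0$: finitary quantifier-free formulas; $\Sigma^{\mathrm{in}}_\alpha$: countable disjunctions of formulas $\exists\bar y\,\psi$ with $\psi\in\Pi^{\mathrm{in}}_\beta$, $\beta<\alpha$; $\Pi^{\mathrm{in}}_\alpha$: dual). $\Sigma^{\mathrm c}_\alpha$ and $\Pi^{\mathrm c}_\alpha$, for computable $\alpha$, are the corresponding classes of computable infinitary formulas in the sense of Ash and Knight (c.e. disjunctions and conjunctions). A structure $\mathcal A$ has Scott rank $\alpha$ if $\alpha$ is least such that the automorphism orbit of every tuple in $\mathcal A$ is $\Sigma^{\mathrm{in}}_\alpha$-definable (without parameters). It has computably defined Scott rank $\alpha$ if $\alpha$ is least such that every automorphism orbit of a tuple is $\Sigma^{\mathrm c}_\beta$-definable (without parameters)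 for some $\beta\le\alpha$. Note that for limit $\alpha$, an orbit defined by a $\Sigma_\alpha$ formula is defined by one of its disjuncts, hence by a $\Sigma_\beta$ formula with $\beta<\alpha$; accordingly, for $\alpha=\omega_1^{\mathrm{ck}}$ (where there are no $\Sigma^{\mathrm c}_{\omega_1^{\mathrm{ck}}}$ formulas) the condition means that every orbit is $\Sigma^{\mathrm c}_\beta$-definable for some $\beta<\omega_1^{\mathrm{ck}}$. *)

(* Defs.v *)
From Stdlib Require Import List Arith Cantor.
Import ListNotations.

(* [Osup f] denotes the least ordinal strictly above every [f n].  Every
   countable ordinal is denoted by such a tree; distinct trees may denote the
   same ordinal, so equality of ordinals is [oeq]. *)
Inductive ord : Type :=
| Ozero : ord
| Osup : (nat -> ord) -> ord.

Fixpoint ole (a b : ord) : Prop :=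
  match a with
  | Ozero => True
  | Osup f =>
      forall n, match b with
                | Ozero => False
                | Osup g => exists m, ole (f n) (g m)
                end
  end.

Definition olt (a b : ord) : Prop :=
  match b with
  | Ozero => False
  | Osup g => exists m, ole a (g m)
  end.

Definition oeq (a b : ord) : Prop := ole a b /\ ole b a.

Definition osucc (a : ord) : ord := Osup (fun _ => a).

Definition olimit (a : ord) : Prop :=
  olt Ozero a /\ forall b, olt b a -> olt (osucc b) a.

Definition npair (x y : nat) : nat := Cantor.to_nat (x, y).
Definition pfst (p : nat) : nat := fst (Cantor.of_nat p).
Definition psnd (p : nat) : nat := snd (Cantor.of_nat p).

(* Kleene's mu-recursive functions; several arguments are passed as one through
   the bijective Cantor pairing, so that [PairOf Fst Snd] is the identity. *)
Inductive code : Type :=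
| Zero | Succ | Fst | Snd
| PairOf (c d : code)
| Comp (c d : code)
| PrimRec (c d : code)
| Mu (c : code).

(* [ev c x y]: the function with program [c] converges on [x], with value
   [y]. *)
Inductive ev : code -> nat -> nat -> Prop :=
| ev_Zero x : ev Zero x 0
| ev_Succ x : ev Succ x (S x)
| ev_Fst x : ev Fst x (pfst x)
| ev_Snd x : ev Snd x (psnd x)
| ev_PairOf c d x y z : ev c x y -> ev d x z -> ev (PairOf c d) x (npair y z)
| ev_Comp c d x y z : ev d x y -> ev c y z -> ev (Comp c d) x z
| ev_PrimRec_0 c d x y : ev c x y -> ev (PrimRec c d) (npair x 0) y
| ev_PrimRec_S c d x n y z :
    ev (PrimRec c d) (npair x n) y -> ev d (npair x (npair n y)) z ->
    ev (PrimRec c d) (npair x (S n)) z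
| ev_Mu c x n :
    (forall k, k < n -> exists y, ev c (npair x k) (S y)) ->
    ev c (npair x n) 0 -> ev (Mu c) x n.

Fixpoint code_num (c : code) : nat :=
  match c with
  | Zero => npair 0 0
  | Succ => npair 1 0
  | Fst => npair 2 0
  | Snd => npair 3 0
  | PairOf c d => npair 4 (npair (code_num c) (code_num d))
  | Comp c d => npair 5 (npair (code_num c) (code_num d))
  | PrimRec c d => npair 6 (npair (code_num c) (code_num d))
  | Mu c => npair 7 (code_num c)
  end.

(* [phi e x y] is "phi_e(x) = y"; a number [e] that is not the number of a
   program is an index of the empty function. *)
Definition phi (e x y : nat) : Prop := exists c, code_num c = e /\ ev c x y.

Definition W (e x : nat) : Prop := exists y, phi e x y.

Definition decides_at (c : code) (x : nat) (P : Prop) : Prop :=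
  (P -> ev c x 1) /\ (~ P -> ev c x 0).

Definition computable_set (D : nat -> Prop) : Prop :=
  exists c, forall x, decides_at c x (D x).

Fixpoint list_num (l : list nat) : nat :=
  match l with
  | [] => 0
  | x :: l => S (npair x (list_num l))
  end.

(* [r] is the isomorphism of [(D, R)] onto the ordinals below [a]. *)
Definition order_type (D : nat -> Prop) (R : nat -> nat -> Prop) (a : ord)
    : Prop :=
  (forall x y, D x -> D y -> R x y \/ x = y \/ R y x) /\
  exists r : nat -> ord,
    (forall x y, D x -> D y -> (R x y <-> olt (r x) (r y))) /\
    (forall x, D x -> olt (r x) a) /\
    (forall b, olt b a -> exists x, D x /\ oeq (r x) b).

Definition computable_ordinal (a : ord) : Prop :=
  exists (D : nat -> Prop) (R : nat -> nat -> Prop),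
    computable_set D /\
    (exists c, forall x y, D x -> D y -> decides_at c (npair x y) (R x y)) /\
    order_type D R a.

Definition is_omega1ck (a : ord) : Prop :=
  ~ computable_ordinal a /\ forall b, ~ computable_ordinal b -> ole a b.

(* Generated as a relation on all numbers; only its restriction to O, which is
   closed downwards, is meaningful. *)
Inductive ltO : nat -> nat -> Prop :=
| ltO_succ a : a <> 0 -> ltO a (2 ^ a)
| ltO_succ_trans b a : ltO b a -> ltO b (2 ^ a)
| ltO_lim b e n c : phi e n c -> ltO b c -> ltO b (3 * 5 ^ e).

(* [notation a al]: [a] is in O and [|a| = al].  In the limit case [Osup al] is
   the supremum of the [al n], since these are strictly increasing. *)
Inductive notation : nat -> ord -> Prop :=
| notation_zero : notation 1 Ozero
| notation_succ a al : notation a al -> notation (2 ^ a) (osucc al)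
| notation_lim e (s : nat -> nat) (al : nat -> ord) :
    (forall n, phi e n (s n)) ->
    (forall n, ltO (s n) (s (S n))) ->
    (forall n, notation (s n) (al n)) ->
    notation (3 * 5 ^ e) (Osup al).

(* Symbols are natural numbers; constants are function symbols of arity 0. *)
Record vocabulary : Type := Vocabulary {
  is_rel : nat -> Prop;
  rel_arity : nat -> nat;
  is_fun : nat -> Prop;
  fun_arity : nat -> nat
}.

Definition computable_vocabulary (V : vocabulary) : Prop :=
  computable_set (is_rel V) /\
  (exists c, forall s, is_rel V s -> ev c s (rel_arity V s)) /\
  computable_set (is_fun V) /\
  (exists c, forall s, is_fun V s -> ev c s (fun_arity V s)).

(* Universes are nonempty, possibly finite, sets of natural numbers.  The values
   of [rel] and [fn] matter only at symbols of [V] applied to tuples of elements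
   of the right length. *)
Record structure (V : vocabulary) : Type := Structure {
  dom : nat -> Prop;
  rel : nat -> list nat -> Prop;
  fn : nat -> list nat -> nat;
  dom_nonempty : exists x, dom x;
  fn_dom : forall s xs, is_fun V s -> length xs = fun_arity V s ->
    Forall dom xs -> dom (fn s xs)
}.
Arguments dom {V} _ _.
Arguments rel {V} _ _ _.
Arguments fn {V} _ _ _.

Definition computable_structure {V : vocabulary} (A : structure V) : Prop :=
  computable_set (dom A) /\
  (exists c, forall s xs, is_rel V s -> length xs = rel_arity V s ->
     Forall (dom A) xs -> decides_at c (npair s (list_num xs)) (rel A s xs)) /\
  (exists c, forall s xs, is_fun V s -> length xs = fun_arity V s ->
     Forall (dom A) xs -> ev c (npair s (list_num xs)) (fn A s xs)).

Definition automorphism {V : vocabulary} (A : structure V) (g : nat -> nat)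
    : Prop :=
  (forall x, dom A x -> dom A (g x)) /\
  (forall x y, dom A x -> dom A y -> g x = g y -> x = y) /\
  (forall y, dom A y -> exists x, dom A x /\ g x = y) /\
  (forall s xs, is_rel V s -> length xs = rel_arity V s ->
     Forall (dom A) xs -> (rel A s xs <-> rel A s (map g xs))) /\
  (forall s xs, is_fun V s -> length xs = fun_arity V s ->
     Forall (dom A) xs -> g (fn A s xs) = fn A s (map g xs)).

Definition same_orbit {V : vocabulary} (A : structure V) (xs ys : list nat)
    : Prop :=
  exists g, automorphism A g /\ ys = map g xs.

Inductive term : Type :=
| Var (x : nat)
| App (s : nat) (ts : list term).

Inductive qform : Type :=
| QTrue
| QEq (t u : term)
| QRel (s : nat) (ts : list term)
| QNot (q : qform)
| QAnd (q r : qform)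
| QOr (q r : qform).

(* Well-formed over [V], with variables among x_0, ..., x_{n-1}. *)
Inductive term_wf (V : vocabulary) (n : nat) : term -> Prop :=
| term_wf_Var x : x < n -> term_wf V n (Var x)
| term_wf_App s ts :
    is_fun V s -> length ts = fun_arity V s ->
    (forall t, In t ts -> term_wf V n t) -> term_wf V n (App s ts).

Fixpoint qform_wf (V : vocabulary) (n : nat) (q : qform) : Prop :=
  match q with
  | QTrue => True
  | QEq t u => term_wf V n t /\ term_wf V n u
  | QRel s ts =>
      is_rel V s /\ length ts = rel_arity V s /\
      forall t, In t ts -> term_wf V n t
  | QNot q => qform_wf V n q
  | QAnd q r | QOr q r => qform_wf V n q /\ qform_wf V n r
  end.

(* The tuple [v] interprets x_0, ..., x_{length v - 1}. *)
Fixpoint term_val {V : vocabulary} (A : structure V) (v : list nat) (t : term)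
    : nat :=
  match t with
  | Var x => nth x v 0
  | App s ts => fn A s (map (term_val A v) ts)
  end.

Fixpoint qsat {V : vocabulary} (A : structure V) (v : list nat) (q : qform)
    : Prop :=
  match q with
  | QTrue => True
  | QEq t u => term_val A v t = term_val A v u
  | QRel s ts => rel A s (map (term_val A v) ts)
  | QNot q => ~ qsat A v q
  | QAnd q r => qsat A v q /\ qsat A v r
  | QOr q r => qsat A v q \/ qsat A v r
  end.

Fixpoint term_num (t : term) : nat :=
  match t with
  | Var x => npair 0 x
  | App s ts => npair 1 (npair s (list_num (map term_num ts)))
  end.

Fixpoint qform_num (q : qform) : nat :=
  match q with
  | QTrue => npair 0 0
  | QEq t u => npair 1 (npair (term_num t) (term_num u))
  | QRel s ts => npair 2 (npair s (list_num (map term_num ts)))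
  | QNot q => npair 3 (qform_num q)
  | QAnd q r => npair 4 (npair (qform_num q) (qform_num r))
  | QOr q r => npair 5 (npair (qform_num q) (qform_num r))
  end.

(* In a context of [n] free variables x_0, ..., x_{n-1}, [Disj J k F] is the
   disjunction over the (possibly empty) set [J] of the formulas
   "exists x_n ... x_{n + k i - 1}, F i"; dually for [Conj]. *)
Inductive form : Type :=
| QF (q : qform)
| Disj (J : nat -> Prop) (k : nat -> nat) (F : nat -> form)
| Conj (J : nat -> Prop) (k : nat -> nat) (F : nat -> form).

Fixpoint sat {V : vocabulary} (A : structure V) (v : list nat) (f : form)
    : Prop :=
  match f with
  | QF q => qsat A v q
  | Disj J k F =>
      exists i, J i /\ exists w, length w = k i /\ Forall (dom A) w /\
        sat A (v ++ w) (F i)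
  | Conj J k F =>
      forall i, J i -> forall w, length w = k i -> Forall (dom A) w ->
        sat A (v ++ w) (F i)
  end.

Inductive side : Type := Sigma | Pi.

(* [infinitary V Sigma al n f]: [f] is a Sigma^in_al formula over [V] with free
   variables among x_0, ..., x_{n-1}; [infinitary V Pi al n f]: it is
   Pi^in_al. *)
Inductive infinitary (V : vocabulary) : side -> ord -> nat -> form -> Prop :=
| infinitary_QF s al n q :
    oeq al Ozero -> qform_wf V n q -> infinitary V s al n (QF q)
| infinitary_Disj al n J k F (be : nat -> ord) :
    olt Ozero al ->
    (forall i, J i -> olt (be i) al) ->
    (forall i, J i -> infinitary V Pi (be i) (n + k i) (F i)) ->
    infinitary V Sigma al n (Disj J k F)
| infinitary_Conj al n J k F (be : nat -> ord) :
    olt Ozero al ->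
    (forall i, J i -> olt (be i) al) ->
    (forall i, J i -> infinitary V Sigma (be i) (n + k i) (F i)) ->
    infinitary V Pi al n (Conj J k F).

(* The index of a finitary formula is the pair of 2 and its Goedel number; the
   disjunction (tag 0) or conjunction (tag 1) at level [a] of O, in [n]
   variables, over the c.e. set [W e] has as index the quadruple (tag, a, n, e).
   An element of [W e] is a pair (k, i) of the number of newly quantified
   variables and an index [i] at some level below [a].  An index determines its
   formula except for the irrelevant values of [F] outside [W e].  The relation
   is meaningful for [a] in O. *)
Inductive index_of (V : vocabulary) : side -> nat -> nat -> form -> nat -> Prop :=
| index_QF s n q :
    qform_wf V n q -> index_of V s 1 n (QF q) (npair 2 (qform_num q))
| index_Disj a n e F (b : nat -> nat) :
    a <> 1 ->
    (forall m, W e m -> ltO (b m) a) ->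
    (forall m, W e m -> index_of V Pi (b m) (n + pfst m) (F m) (psnd m)) ->
    index_of V Sigma a n (Disj (W e) pfst F) (npair 0 (npair a (npair n e)))
| index_Conj a n e F (b : nat -> nat) :
    a <> 1 ->
    (forall m, W e m -> ltO (b m) a) ->
    (forall m, W e m -> index_of V Sigma (b m) (n + pfst m) (F m) (psnd m)) ->
    index_of V Pi a n (Conj (W e) pfst F) (npair 1 (npair a (npair n e))).

(* Sigma^c_al (resp. Pi^c_al), with respect to some notation for [al]. *)
Definition computable_infinitary (V : vocabulary) (s : side) (al : ord)
    (n : nat) (f : form) : Prop :=
  exists a al' i, notation a al' /\ oeq al' al /\ index_of V s a n f i.

Definition defines_orbit {V : vocabulary} (A : structure V) (f : form)
    (xs : list nat) : Prop :=
  forall ys, length ys = length xs -> Forall (dom A) ys ->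
    (sat A ys f <-> same_orbit A xs ys).

Definition orbits_Sigma_in {V : vocabulary} (A : structure V) (al : ord)
    : Prop :=
  forall xs, Forall (dom A) xs ->
    exists f, infinitary V Sigma al (length xs) f /\ defines_orbit A f xs.

Definition orbits_Sigma_c {V : vocabulary} (A : structure V) (al : ord)
    : Prop :=
  forall xs, Forall (dom A) xs ->
    exists be f, ole be al /\
      computable_infinitary V Sigma be (length xs) f /\ defines_orbit A f xs.

Definition least (P : ord -> Prop) (al : ord) : Prop :=
  P al /\ forall be, P be -> ole al be.

Definition scott_rank {V : vocabulary} (A : structure V) (al : ord) : Prop :=
  least (orbits_Sigma_in A) al.

Definition computably_defined_scott_rank {V : vocabulary} (A : structure V)
    (al : ord) : Prop :=
  least (orbits_Sigma_c A) al.

(* Main.v *)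
Require Import Defs.
From Stdlib Require Import List Arith Lia Cantor Classical ClassicalEpsilon.
From Stdlib Require Import IndefiniteDescription.
Import ListNotations.

(** Every Sigma^c formula is a Sigma^in formula of the same level, so the content is the
    passage from infinitary to computable definitions of orbits ([least_iff] does the rest).

    The tool is the Scott analysis of a computable structure, run along Kleene's O.  By
    recursion on a notation [b], each tuple [t] receives a formula [phi_{t,b}] satisfied by
    [t]: at the bottom it lists the literals true of [t]; two levels higher it says that every
    extension of [t] is matched by an extension of the tuple under consideration, and
    conversely, up to the earlier equivalence:
<<
      phi_{t,2^2^c}(x) = AND_u  EX y  phi_{tu,c}(xy)   /\   ALL y  OR_u  phi_{tu,c}(xy);
>>
    at limits it is the conjunction of the formulas along the fundamental sequence.  One
    back-and-forth step absorbs one quantifier alternation, so a tuple satisfying [phi_{t,b}]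
    satisfies the same formulas as [t] up to any level [be] with [cost be <= |b|], where
    [cost be] is 3 + 2.be ([scott_formulas]).  A limit ordinal above [be] is also above
    [cost be] ([cost_limit]).

    Let now an orbit be defined by a Sigma^in_al formula.  One disjunct, true of the tuple [xs]
    with witnesses [w], already defines it; this disjunct is a Pi^in_ga formula with [ga < al].
    If [cost ga <= |b|], then [EX w. phi_{xs w,b}] defines the orbit too ([orbit_Sigma_c]), and
    it is Sigma^c at the successor of [|b|].  For [al = lambda] one takes [|b| = cost ga], which
    is below [lambda]; for [al = lambda + 1] one takes [|b| = lambda].  For [al = 1] the disjunct
    is finitary, and nothing has to be computed.

    Two effective ingredients remain.  First, the index of [phi_{t,b}] must be computable from
    [t] and [b].  Every c.e. set involved is the range of [k |-> G p (phi_e k)] for one total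
    computable function [G] ([enumerator]) and suitable data [e] and [p].  The program that
    searches such a range is an explicit template around the program of [G]
    ([range_template]).  The elements enumerated by [G] contain numbers of programs built from
    that same template, but the number of the template is handed to [G] inside [p]; so neither
    the recursion theorem nor a universal function is needed, and an [e] extracted from a limit
    notation is just pasted into the template as a subprogram.  Second, a computable
    well-ordering must be bounded by a notation: this is a sum along its initial segments,
    programmed with the same trick ([notation_of_well_order]). *)

(** * Ordinals as trees *)

Lemma ole_refl a : ole a a.
Proof. induction a as [|f IH]; simpl; eauto. Qed.

Lemma ole_trans b : forall a c, ole a b -> ole b c -> ole a c.
Proof.
  induction b as [|g IH]; intros [|f] c Hab Hbc; try exact I.
  - destruct (Hab 0).
  - intros n. destruct (Hab n) as [m Hm]. specialize (Hbc m).
    destruct c as [|h]; [easy|]. destruct Hbc as [p Hp]. eauto.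
Qed.

Lemma olt_ole_trans a b c : olt a b -> ole b c -> olt a c.
Proof.
  destruct b as [|g]; simpl; [easy|]. intros [m Hm] H.
  destruct c as [|h]; simpl in *; [destruct (H 0)|].
  destruct (H m) as [p Hp]. exists p. now apply ole_trans with (g m).
Qed.

Lemma ole_olt_trans a b c : ole a b -> olt b c -> olt a c.
Proof.
  destruct c as [|h]; simpl; [easy|]. intros H [p Hp]. exists p.
  now apply ole_trans with b.
Qed.

Lemma ole_Osup f b : (forall n, olt (f n) b) -> ole (Osup f) b.
Proof. destruct b; simpl; auto. Qed.

Lemma olt_Osup f n : olt (f n) (Osup f).
Proof. exists n. apply ole_refl. Qed.

Lemma olt_osucc a : olt a (osucc a).
Proof. exists 0. apply ole_refl. Qed.

Lemma olt_ole a : forall b, olt a b -> ole a b.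
Proof.
  induction a as [|f IH]; intros b H; [exact I|].
  apply ole_Osup. intros n. destruct b as [|g]; [easy|]. destruct H as [m Hm].
  exists m. apply IH. eapply olt_ole_trans; [apply olt_Osup|exact Hm].
Qed.

Lemma olt_trans a b c : olt a b -> olt b c -> olt a c.
Proof. intros H1 H2. apply olt_ole in H1. eapply ole_olt_trans; eauto. Qed.

Lemma olt_irrefl a : ~ olt a a.
Proof.
  induction a as [|f IH]; [easy|]. intros [m Hm].
  apply (IH m). eapply olt_ole_trans; [apply olt_Osup|exact Hm].
Qed.

Lemma not_ole_olt a : forall b, ~ ole a b -> olt b a.
Proof.
  induction a as [|f IH]; intros b H; [now destruct H|].
  apply NNPP. intros Hn. apply H. apply ole_Osup. intros n.
  apply NNPP. intros Hf. apply Hn. exists n.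
  clear H Hn. revert Hf. generalize (f n), (IH n). clear.
  intros a IHa Hab. destruct b as [|g]; [exact I|]. intros m.
  apply IHa. intros Hle. apply Hab. now exists m.
Qed.

Lemma ole_or_olt a b : ole a b \/ olt b a.
Proof. destruct (classic (ole a b)); auto using not_ole_olt. Qed.

Lemma osucc_ole a b : ole (osucc a) b <-> olt a b.
Proof.
  split; intros H.
  - eapply olt_ole_trans; [apply olt_osucc|exact H].
  - now apply ole_Osup.
Qed.

Lemma olt_osucc_iff a b : olt a (osucc b) <-> ole a b.
Proof. split; [intros [_ H]; exact H|intros H; now exists 0]. Qed.

Lemma osucc_ole_osucc a b : ole (osucc a) (osucc b) <-> ole a b.
Proof. rewrite osucc_ole. apply olt_osucc_iff. Qed.

Lemma olt_ind (P : ord -> Prop) :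
  (forall a, (forall b, olt b a -> P b) -> P a) -> forall a, P a.
Proof.
  intros H a. apply H. induction a as [|f IH]; [easy|].
  intros b [m Hm]. apply H. intros c Hc. apply (IH m).
  eapply olt_ole_trans; eauto.
Qed.

(** The ordinal 3 + 2.a.  Two levels pay for one block of quantifiers; the initial 3 pays for
    the literals and for one step that names the values of all subterms. *)
Fixpoint cost (a : ord) : ord :=
  match a with
  | Ozero => osucc (osucc (osucc Ozero))
  | Osup f => Osup (fun n => osucc (cost (f n)))
  end.

Lemma cost_ge3 a : ole (cost Ozero) (cost a).
Proof.
  induction a as [|f IH]; [apply ole_refl|].
  eapply ole_trans; [apply (IH 0)|]. apply olt_ole.
  eapply olt_trans; [apply olt_osucc|]. apply (olt_Osup (fun n => osucc (cost (f n)))).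
Qed.

Lemma cost_mono a : forall b, ole a b -> ole (cost a) (cost b).
Proof.
  induction a as [|f IH]; intros b H; [apply cost_ge3|].
  apply ole_Osup. intros n. destruct b as [|g]; [destruct (H 0)|].
  destruct (H n) as [m Hm]. exists m. apply osucc_ole_osucc. auto.
Qed.

Lemma cost_step a b : olt a b -> ole (osucc (osucc (cost a))) (cost b).
Proof.
  destruct b as [|g]; [easy|]. intros [m Hm].
  apply osucc_ole. exists m. apply osucc_ole_osucc. now apply cost_mono.
Qed.

Lemma olimit_succ a b : olimit a -> olt b a -> olt (osucc b) a.
Proof. intros [_ H]. auto. Qed.

(** If [a] itself is a limit, induction gives [cost (f n) < a], so [cost a <= a]; otherwise some
    [f m] is largest and [cost a] is two steps above [cost (f m)].  Quantifying over all limits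
    [l] is what lets the induction hypothesis be used at [a]. *)
Lemma cost_limit a : forall l, olimit l -> olt a l -> olt (cost a) l.
Proof.
  induction a as [|f IH]; intros l Hl Ha.
  - simpl. pose proof (proj1 Hl). auto using olimit_succ.
  - assert (Hf : forall n, olt (f n) l)
      by (intros n; eapply olt_trans; [apply olt_Osup|exact Ha]).
    destruct (classic (exists m, forall n, ole (f n) (f m))) as [[m Hm]|Hlim].
    + assert (H : ole (cost (Osup f)) (osucc (osucc (cost (f m))))).
      { apply ole_Osup. intros n. apply olt_osucc_iff, osucc_ole_osucc.
        now apply cost_mono. }
      eapply ole_olt_trans; [exact H|]. auto using olimit_succ.
    + assert (HL : olimit (Osup f)).
      { split; [now exists 0|]. intros b [n Hn].
        assert (exists m, olt (f n) (f m)) as [m Hm].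
        { apply NNPP. intros Hc. apply Hlim. exists n. intros m.
          destruct (ole_or_olt (f m) (f n)); [auto|]. destruct Hc. eauto. }
        exists m. apply osucc_ole. eapply ole_olt_trans; eauto. }
      eapply ole_olt_trans; [|exact Ha]. apply ole_Osup. intros n.
      apply olimit_succ; [exact HL|]. apply IH; [exact HL|apply olt_Osup].
Qed.

Lemma cost_limit_self l : olimit l -> ole (cost l) l.
Proof.
  intros Hl. destruct l as [|f]; [destruct (proj1 Hl)|].
  apply ole_Osup. intros n. apply olimit_succ, cost_limit; auto. apply olt_Osup.
Qed.

(** * Programs and total computable functions *)

Lemma pfst_npair x y : pfst (npair x y) = x.
Proof. unfold pfst, npair. now rewrite Cantor.cancel_of_to. Qed.

Lemma psnd_npair x y : psnd (npair x y) = y.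
Proof. unfold psnd, npair. now rewrite Cantor.cancel_of_to. Qed.

Lemma npair_eta p : npair (pfst p) (psnd p) = p.
Proof.
  unfold npair, pfst, psnd. rewrite <- surjective_pairing. apply Cantor.cancel_to_of.
Qed.

Lemma npair_inj x y x' y' : npair x y = npair x' y' -> x = x' /\ y = y'.
Proof.
  intros H. split.
  - now rewrite <- (pfst_npair x y), H, pfst_npair.
  - now rewrite <- (psnd_npair x y), H, psnd_npair.
Qed.

Lemma npair_ge x y : x + y <= npair x y.
Proof. rewrite Nat.add_comm. apply Cantor.to_nat_non_decreasing. Qed.

(* Unification must not start computing with the Cantor pairing. *)
Opaque npair pfst psnd.

Ltac pairs := cbv beta; repeat first [rewrite pfst_npair | rewrite psnd_npair].

(** Stated with a variable input, since inversion on [npair x n] would unfold the pairing. *)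
Lemma ev_PrimRec_inv c d p w : ev (PrimRec c d) p w ->
  (exists x, p = npair x 0 /\ ev c x w) \/
  (exists x n y, p = npair x (S n) /\ ev (PrimRec c d) (npair x n) y /\
     ev d (npair x (npair n y)) w).
Proof. intros H. inversion H; subst; eauto 10. Qed.

Lemma ev_functional c : forall x y z, ev c x y -> ev c x z -> y = z.
Proof.
  induction c as [| | | |c IHc d IHd|c IHc d IHd|c IHc d IHd|c IHc];
    intros x y z Hy Hz.
  1-4: inversion Hy; inversion Hz; congruence.
  - inversion Hy; inversion Hz; subst. f_equal; eauto.
  - inversion Hy as [| | | | |? ? ? y' ? Hd Hc| | |].
    inversion Hz as [| | | | |? ? ? z' ? Hd' Hc'| | |]; subst.
    rewrite (IHd _ _ _ Hd Hd') in Hc. eauto.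
  - rewrite <- (npair_eta x) in *. revert y z Hy Hz.
    induction (psnd x) as [|n IH]; intros y z Hy Hz;
      apply ev_PrimRec_inv in Hy as [(x1 & E1 & Hy)|(x1 & n1 & y1 & E1 & Hy & Hy')];
      apply ev_PrimRec_inv in Hz as [(x2 & E2 & Hz)|(x2 & n2 & y2 & E2 & Hz & Hz')];
      apply npair_inj in E1 as [<- E1]; apply npair_inj in E2 as [<- E2];
      try discriminate; eauto.
    injection E1 as <-. injection E2 as <-.
    rewrite (IH _ _ Hy Hz) in Hy'. eauto.
  - inversion Hy as [| | | | | | | |? ? ? Hlow H0]; subst.
    inversion Hz as [| | | | | | | |? ? ? Hlow' H0']; subst.
    destruct (lt_eq_lt_dec y z) as [[Hl|E]|Hl]; [exfalso|exact E|exfalso].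
    + destruct (Hlow' y Hl) as [k Hk]. discriminate (IHc _ _ _ H0 Hk).
    + destruct (Hlow z Hl) as [k Hk]. discriminate (IHc _ _ _ H0' Hk).
Qed.

Lemma code_num_inj c : forall d, code_num c = code_num d -> c = d.
Proof.
  induction c; intros [] H; simpl in H; apply npair_inj in H as [H1 H2];
    try discriminate; try reflexivity; try apply npair_inj in H2 as [H2 H3];
    f_equal; auto.
Qed.

Lemma phi_code_num c x y : phi (code_num c) x y <-> ev c x y.
Proof.
  split; [|now exists c]. intros (d & Hd & H). now rewrite <- (code_num_inj _ _ Hd).
Qed.

Lemma phi_functional e x y z : phi e x y -> phi e x z -> y = z.
Proof.
  intros (c & Hc & H) (d & Hd & H'). subst e.
  apply code_num_inj in Hd. subst d. eapply ev_functional; eauto.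
Qed.

(** Only total functions are treated: the partial ones in the proof are searches, handled once
    and for all by [range_template]. *)
Definition computable (f : nat -> nat) : Prop := exists c, forall x, ev c x (f x).

Definition decidable_by (p : nat -> bool) : Prop :=
  computable (fun x => Nat.b2n (p x)).

Lemma computable_ext f g : (forall x, f x = g x) -> computable f -> computable g.
Proof. intros E [c H]. exists c. intros x. now rewrite <- E. Qed.

Lemma computable_id : computable (fun x => x).
Proof.
  exists (PairOf Fst Snd). intros x. rewrite <- (npair_eta x) at 2.
  repeat constructor.
Qed.

Lemma computable_comp f g :
  computable f -> computable g -> computable (fun x => f (g x)).
Proof. intros [c Hc] [d Hd]. exists (Comp c d). intros x. econstructor; eauto. Qed.

Lemma computable_pair f g :
  computable f -> computable g -> computable (fun x => npair (f x) (g x)).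
Proof. intros [c Hc] [d Hd]. exists (PairOf c d). intros x. constructor; eauto. Qed.

Lemma computable_binary (op : nat -> nat -> nat) :
  computable (fun p => op (pfst p) (psnd p)) ->
  forall f g, computable f -> computable g -> computable (fun x => op (f x) (g x)).
Proof.
  intros H f g Hf Hg.
  pose proof (computable_comp _ _ H (computable_pair _ _ Hf Hg)) as K.
  revert K. apply computable_ext. intros x. now pairs.
Qed.

Lemma computable_ternary (op : nat -> nat -> nat -> nat) :
  computable (fun p => op (pfst p) (pfst (psnd p)) (psnd (psnd p))) ->
  forall f g h, computable f -> computable g -> computable h ->
  computable (fun x => op (f x) (g x) (h x)).
Proof.
  intros H f g h Hf Hg Hh.
  pose proof (computable_comp _ _ H
    (computable_pair _ _ Hf (computable_pair _ _ Hg Hh))) as K.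
  revert K. apply computable_ext. intros x. now pairs.
Qed.

Lemma computable_S f : computable f -> computable (fun x => S (f x)).
Proof. apply (computable_comp S). exists Succ. intros. constructor. Qed.

Lemma computable_pfst f : computable f -> computable (fun x => pfst (f x)).
Proof. apply (computable_comp pfst). exists Fst. intros. constructor. Qed.

Lemma computable_psnd f : computable f -> computable (fun x => psnd (f x)).
Proof. apply (computable_comp psnd). exists Snd. intros. constructor. Qed.

Fixpoint Const (n : nat) : code :=
  match n with 0 => Zero | S n => Comp Succ (Const n) end.

Lemma ev_Const n x : ev (Const n) x n.
Proof. induction n; simpl; econstructor; eauto. constructor. Qed.

Lemma computable_const n : computable (fun _ => n).
Proof. exists (Const n). apply ev_Const. Qed.

Lemma ev_PrimRec c d (f : nat -> nat) (g : nat -> nat -> nat -> nat) x n :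
  ev c x (f x) ->
  (forall n y, ev d (npair x (npair n y)) (g x n y)) ->
  ev (PrimRec c d) (npair x n) (nat_rect (fun _ => nat) (f x) (g x) n).
Proof.
  intros Hc Hd. induction n; simpl; econstructor; eauto.
Qed.

Lemma computable_rec f g h :
  computable f ->
  computable (fun x => g (pfst x) (pfst (psnd x)) (psnd (psnd x))) ->
  computable h ->
  computable (fun x => nat_rect (fun _ => nat) (f x) (fun n y => g x n y) (h x)).
Proof.
  intros [c Hc] [d Hd] Hh.
  assert (computable (fun x => nat_rect (fun _ => nat) (f (pfst x)) (g (pfst x)) (psnd x))) as H.
  { exists (PrimRec c d). intros x. rewrite <- (npair_eta x) at 1.
    apply ev_PrimRec; auto. intros n y.
    specialize (Hd (npair (pfst x) (npair n y))).
    now rewrite !psnd_npair, !pfst_npair in Hd. }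
  pose proof (computable_comp _ _ H (computable_pair _ _ computable_id Hh)) as K.
  revert K. apply computable_ext. intros x. now pairs.
Qed.

Create HintDb comp.
#[local] Hint Constants Opaque : comp.
#[local] Hint Variables Opaque : comp.
#[local] Hint Resolve computable_id computable_pair computable_S computable_pfst
  computable_psnd computable_const : comp.
#[local] Hint Extern 4 (computable _) =>
  match goal with |- computable (fun x => ?f (@?g x)) =>
    is_var f; apply (computable_comp f g) end : comp.
Ltac comp := cbv beta; auto 60 with comp nocore.

Lemma computable_add f g :
  computable f -> computable g -> computable (fun x => f x + g x).
Proof.
  apply computable_binary.
  apply computable_ext with (fun p => nat_rect (fun _ => nat) (pfst p) (fun _ y => S y) (psnd p)).
  - intros p. induction (psnd p); simpl; lia.
  - apply computable_rec with (g := fun _ _ y => S y); comp.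
Qed.
#[local] Hint Resolve computable_add : comp.

Lemma computable_mul f g :
  computable f -> computable g -> computable (fun x => f x * g x).
Proof.
  apply computable_binary.
  apply computable_ext with
    (fun p => nat_rect (fun _ => nat) 0 (fun _ y => pfst p + y) (psnd p)).
  - intros p. induction (psnd p); simpl; lia.
  - apply computable_rec with (g := fun p _ y => pfst p + y); comp.
Qed.
#[local] Hint Resolve computable_mul : comp.

Lemma computable_pow f g :
  computable f -> computable g -> computable (fun x => f x ^ g x).
Proof.
  apply computable_binary.
  apply computable_ext with
    (fun p => nat_rect (fun _ => nat) 1 (fun _ y => pfst p * y) (psnd p)).
  - intros p. induction (psnd p); simpl; lia.
  - apply computable_rec with (g := fun p _ y => pfst p * y); comp.
Qed.
#[local] Hint Resolve computable_pow : comp.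

Lemma computable_pred f : computable f -> computable (fun x => pred (f x)).
Proof.
  apply computable_comp with (f := pred).
  apply computable_ext with (fun p => nat_rect (fun _ => nat) 0 (fun n _ => n) p).
  - intros p. destruct p; reflexivity.
  - apply computable_rec with (g := fun _ n _ => n); comp.
Qed.
#[local] Hint Resolve computable_pred : comp.

Lemma computable_sub f g :
  computable f -> computable g -> computable (fun x => f x - g x).
Proof.
  apply computable_binary.
  apply computable_ext with
    (fun p => nat_rect (fun _ => nat) (pfst p) (fun _ y => pred y) (psnd p)).
  - intros p. induction (psnd p); simpl; lia.
  - apply computable_rec with (g := fun _ _ y => pred y); comp.
Qed.
#[local] Hint Resolve computable_sub : comp.

(** [PrimRec] evaluates [c] only when the recursion argument, here the value of the guard, is
    nonzero; so an algorithm that is correct on a decidable domain becomes total. *)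
Lemma computable_guard p c f :
  decidable_by p -> (forall x, p x = true -> ev c x (f x)) ->
  computable (fun x => if p x then f x else 0).
Proof.
  intros [d Hd] Hc.
  exists (Comp (PrimRec Zero (Comp c Fst)) (PairOf (PairOf Fst Snd) d)). intros x.
  apply ev_Comp with (npair x (Nat.b2n (p x))).
  { constructor; [|apply Hd]. rewrite <- (npair_eta x) at 2. repeat constructor. }
  destruct (p x) eqn:E; simpl.
  - eapply ev_PrimRec_S; [apply ev_PrimRec_0; constructor|].
    econstructor; [constructor|]. rewrite pfst_npair. auto.
  - apply ev_PrimRec_0. constructor.
Qed.

Lemma computable_if p f g :
  decidable_by p -> computable f -> computable g ->
  computable (fun x => if p x then f x else g x).
Proof.
  intros Hp Hf Hg.
  apply computable_ext with
    (fun x => Nat.b2n (p x) * f x + (1 - Nat.b2n (p x)) * g x).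
  - intros x. destruct (p x); simpl; lia.
  - unfold decidable_by in Hp. comp.
Qed.

Lemma decidable_not p : decidable_by p -> decidable_by (fun x => negb (p x)).
Proof.
  unfold decidable_by. intros H.
  apply computable_ext with (fun x => 1 - Nat.b2n (p x)); [|comp].
  intros x. now destruct (p x).
Qed.

Lemma decidable_and p q :
  decidable_by p -> decidable_by q -> decidable_by (fun x => p x && q x)%bool.
Proof.
  unfold decidable_by. intros H K.
  apply computable_ext with (fun x => Nat.b2n (p x) * Nat.b2n (q x)); [|comp].
  intros x. now destruct (p x), (q x).
Qed.

Lemma decidable_leb f g :
  computable f -> computable g -> decidable_by (fun x => f x <=? g x).
Proof.
  intros Hf Hg. unfold decidable_by.
  apply computable_ext with (fun x => 1 - (f x - g x)); [|comp].
  intros x. destruct (Nat.leb_spec (f x) (g x)); cbn [Nat.b2n]; lia.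
Qed.

#[local] Hint Resolve computable_if decidable_not decidable_and decidable_leb : comp.

Lemma decidable_ltb f g :
  computable f -> computable g -> decidable_by (fun x => f x <? g x).
Proof. intros Hf Hg. apply decidable_leb; comp. Qed.

Lemma decidable_ext p q : (forall x, p x = q x) -> decidable_by p -> decidable_by q.
Proof. intros E. apply computable_ext. intros x. now rewrite E. Qed.

Lemma decidable_eqb f g :
  computable f -> computable g -> decidable_by (fun x => f x =? g x).
Proof.
  intros Hf Hg.
  apply decidable_ext with (fun x => (f x <=? g x) && (g x <=? f x))%bool; [|comp].
  intros x. destruct (Nat.eqb_spec (f x) (g x)), (Nat.leb_spec (f x) (g x)),
    (Nat.leb_spec (g x) (f x)); simpl; reflexivity || (exfalso; lia).
Qed.

Lemma decidable_or p q :
  decidable_by p -> decidable_by q -> decidable_by (fun x => p x || q x)%bool.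
Proof.
  intros Hp Hq.
  apply decidable_ext with (fun x => negb (negb (p x) && negb (q x))); [|comp].
  intros x. now destruct (p x), (q x).
Qed.

Lemma decidable_comp p f :
  decidable_by p -> computable f -> decidable_by (fun x => p (f x)).
Proof. apply computable_comp. Qed.

Lemma decidable_if p q r : decidable_by p -> decidable_by q -> decidable_by r ->
  decidable_by (fun x => if p x then q x else r x).
Proof.
  intros Hp Hq Hr.
  apply decidable_ext with (fun x => p x && q x || negb (p x) && r x)%bool.
  - intros x. destruct (p x); [apply Bool.orb_false_r|reflexivity].
  - repeat first [apply decidable_or | apply decidable_and | apply decidable_not]; assumption.
Qed.

Lemma decidable_const b : decidable_by (fun _ => b).
Proof. exact (computable_const (Nat.b2n b)). Qed.

#[local] Hint Resolve decidable_ltb decidable_eqb decidable_or decidable_if decidable_const : comp.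

Lemma computable_b2n p : decidable_by p -> computable (fun x => Nat.b2n (p x)).
Proof. auto. Qed.
#[local] Hint Resolve computable_b2n : comp.

(** * Lists coded by numbers *)

(** [list_num] is a bijection, so every number is read as a list and no validity test for codes
    is ever needed; [lst] is its inverse.  The fuel suffices because a tail has a smaller code. *)
Fixpoint lst_fuel (k n : nat) : list nat :=
  match k, n with
  | S k, S m => pfst m :: lst_fuel k (psnd m)
  | _, _ => []
  end.
Definition lst (n : nat) : list nat := lst_fuel n n.

Lemma lst_fuel_num l : forall k, list_num l <= k -> lst_fuel k (list_num l) = l.
Proof.
  induction l as [|x l IH]; intros k H; simpl in *; [now destruct k|].
  destruct k as [|k]; [lia|]. simpl. pairs. rewrite IH; [reflexivity|].
  pose proof (npair_ge x (list_num l)). lia.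
Qed.

Lemma lst_list_num l : lst (list_num l) = l.
Proof. now apply lst_fuel_num. Qed.

Lemma list_num_lst_fuel k : forall n, n <= k -> list_num (lst_fuel k n) = n.
Proof.
  induction k; intros [|m] H; simpl; try lia. rewrite IHk.
  - now rewrite npair_eta.
  - pose proof (npair_ge (pfst m) (psnd m)). rewrite npair_eta in *. lia.
Qed.

Lemma list_num_lst n : list_num (lst n) = n.
Proof. now apply list_num_lst_fuel. Qed.

Lemma length_list_num l : length l <= list_num l.
Proof.
  induction l as [|x l IH]; simpl; [lia|]. pose proof (npair_ge x (list_num l)). lia.
Qed.

(** The state of the iteration is the pair of the code of the remaining list and the
    accumulator; the code of a list bounds its length, so it serves as number of iterations. *)
Lemma computable_fold g l a :
  computable (fun x => g (pfst x) (pfst (psnd x)) (psnd (psnd x))) ->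
  computable l -> computable a ->
  computable (fun x => fold_left (fun acc h => g x acc h) (lst (l x)) (a x)).
Proof.
  intros Hg Hl Ha.
  pose (step := fun x y : nat => if pfst y =? 0 then y else
     npair (psnd (pred (pfst y))) (g x (psnd y) (pfst (pred (pfst y))))).
  apply computable_ext with (fun x => psnd (nat_rect (fun _ => nat)
    (npair (l x) (a x)) (fun _ y => step x y) (l x))).
  - intros x.
    assert (H : forall k L acc, length L <= k ->
      psnd (nat_rect (fun _ => nat) (npair (list_num L) acc) (fun _ y => step x y) k)
      = fold_left (fun acc h => g x acc h) L acc).
    { intros k L acc HL.
      assert (E : forall k y, nat_rect (fun _ => nat) y (fun _ y => step x y) (S k)
        = nat_rect (fun _ => nat) (step x y) (fun _ y => step x y) k).
      { clear. induction k; intros y; [reflexivity|]. simpl in *. now rewrite IHk. }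
      revert L acc HL. induction k; intros [|h L] acc HL; simpl in HL; try lia.
      - simpl. now pairs.
      - rewrite E. unfold step at 1. simpl. rewrite pfst_npair. apply (IHk []). simpl; lia.
      - rewrite E. unfold step at 1. cbn [list_num]. pairs. simpl. pairs.
        apply IHk. lia. }
    rewrite <- (list_num_lst (l x)) at 1. apply H.
    pose proof (length_list_num (lst (l x))). rewrite list_num_lst in *. lia.
  - apply computable_psnd. apply computable_rec with (g := fun x _ y => step x y); comp.
    unfold step. apply computable_if; [comp|comp|].
    apply computable_pair; [comp|].
    apply (computable_ternary g Hg); comp.
Qed.

Lemma computable_cons f g :
  computable f -> computable g -> computable (fun x => list_num (f x :: lst (g x))).
Proof.
  intros Hf Hg. apply computable_ext with (fun x => S (npair (f x) (g x))); [|comp].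
  intros x. simpl. now rewrite list_num_lst.
Qed.

Lemma fold_left_num {X} (g : list nat -> X -> list nat) (l : list X) : forall a,
  fold_left (fun acc h => list_num (g (lst acc) h)) l (list_num a)
  = list_num (fold_left g l a).
Proof. induction l; intros b; simpl; [reflexivity|]. now rewrite lst_list_num, IHl. Qed.

Lemma fold_left_cons {X Y} (f : X -> Y) (l : list X) : forall a,
  fold_left (fun acc h => f h :: acc) l a = rev (map f l) ++ a.
Proof.
  induction l; intros b; simpl; [reflexivity|]. rewrite IHl, <- app_assoc. reflexivity.
Qed.

Lemma computable_rev_map f l a :
  computable (fun x => f (pfst x) (psnd x)) -> computable l -> computable a ->
  computable (fun x => list_num (rev (map (f x) (lst (l x))) ++ lst (a x))).
Proof.
  intros Hf Hl Ha.
  apply computable_ext with (fun x => fold_left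
    (fun acc h => list_num (f x h :: lst acc)) (lst (l x)) (a x)).
  - intros x. rewrite <- (list_num_lst (a x)) at 1.
    rewrite (fold_left_num (fun acc h => f x h :: acc)). now rewrite fold_left_cons.
  - apply computable_fold with (g := fun x acc h => list_num (f x h :: lst acc)); comp.
    apply computable_cons; comp.
    apply (computable_binary f Hf); comp.
Qed.

Lemma computable_app f g :
  computable f -> computable g ->
  computable (fun x => list_num (lst (f x) ++ lst (g x))).
Proof.
  intros Hf Hg.
  assert (H := computable_rev_map (fun _ h => h) f (fun _ => 0)).
  eapply computable_ext;
    [|apply (computable_rev_map (fun _ h => h)); [comp|apply H; comp|exact Hg]].
  intros x. cbv beta. rewrite lst_list_num, !map_id. change (lst 0) with (@nil nat).
  now rewrite app_nil_r, rev_involutive.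
Qed.

Lemma computable_map f l :
  computable (fun x => f (pfst x) (psnd x)) -> computable l ->
  computable (fun x => list_num (map (f x) (lst (l x)))).
Proof.
  intros Hf Hl.
  assert (H := computable_rev_map f l (fun _ => 0) Hf Hl (computable_const 0)).
  eapply computable_ext;
    [|apply (computable_rev_map (fun _ h => h)); [comp|exact H|apply (computable_const 0)]].
  intros x. cbv beta. rewrite lst_list_num, map_id. change (lst 0) with (@nil nat).
  now rewrite !app_nil_r, rev_involutive.
Qed.

Lemma computable_length l :
  computable l -> computable (fun x => length (lst (l x))).
Proof.
  intros Hl.
  apply computable_ext with (fun x => fold_left (fun acc _ => S acc) (lst (l x)) 0).
  - intros x. rewrite <- (Nat.add_0_r (length _)). generalize 0.
    induction (lst (l x)); intros n; simpl; [reflexivity|]. rewrite IHl0. lia.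
  - apply computable_fold with (g := fun _ acc _ => S acc); comp.
Qed.

Lemma computable_nth i l :
  computable i -> computable l -> computable (fun x => nth (i x) (lst (l x)) 0).
Proof.
  intros Hi Hl.
  apply computable_ext with (fun x => pfst (pred (nat_rect (fun _ => nat) (l x)
     (fun _ y => psnd (pred y)) (i x)))).
  - intros x. rewrite <- (list_num_lst (l x)) at 1.
    assert (E : forall k y, nat_rect (fun _ => nat) y (fun _ y => psnd (pred y)) (S k)
        = nat_rect (fun _ => nat) (psnd (pred y)) (fun _ y => psnd (pred y)) k).
    { clear. induction k; intros y; [reflexivity|]. simpl in *. now rewrite IHk. }
    generalize (lst (l x)). induction (i x) as [|k IH]; intros [|h L]; [reflexivity|simpl; now pairs|..].
    + rewrite E. change (psnd (pred (list_num []))) with (list_num []). rewrite IH.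
      now destruct k.
    + rewrite E. cbn [list_num pred]. pairs. apply IH.
  - apply computable_pfst, computable_pred.
    apply computable_rec with (g := fun _ _ y => psnd (pred y)); comp.
Qed.

Lemma decidable_forallb p l :
  decidable_by (fun x => p (pfst x) (psnd x)) -> computable l ->
  decidable_by (fun x => forallb (p x) (lst (l x))).
Proof.
  intros Hp Hl.
  apply computable_ext with
    (fun x => fold_left (fun acc h => acc * Nat.b2n (p x h)) (lst (l x)) 1).
  - intros x.
    enough (H : forall L b, fold_left (fun acc h => acc * Nat.b2n (p x h)) L (Nat.b2n b)
      = Nat.b2n (b && forallb (p x) L)) by apply (H _ true).
    induction L as [|h L IH]; intros b; simpl.
    + now rewrite Bool.andb_true_r.
    + rewrite Bool.andb_assoc, <- IH. now destruct b, (p x h).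
  - apply computable_fold with (g := fun x acc h => acc * Nat.b2n (p x h)); comp.
    apply computable_mul; [comp|].
    apply (computable_binary (fun x h => Nat.b2n (p x h)) Hp); comp.
Qed.

#[local] Hint Resolve computable_cons computable_app computable_map computable_length
  computable_nth decidable_forallb : comp.

(** Bounded search; the value [n] signals failure. *)
Fixpoint bfind (p : nat -> bool) (n : nat) : nat :=
  match n with
  | 0 => 0
  | S k => if (bfind p k <? k)%nat then bfind p k else if p k then k else S k
  end.

Lemma bfind_spec p n k : k < n -> p k = true ->
  bfind p n < n /\ p (bfind p n) = true.
Proof.
  induction n; intros Hk Hp; [lia|]. simpl.
  destruct (Nat.ltb_spec (bfind p n) n) as [H|H].
  - split; [lia|].
    clear IHn Hk Hp. induction n; [lia|]. simpl in *.
    destruct (Nat.ltb_spec (bfind p n) n); [auto|]. destruct (p n) eqn:E; [exact E|lia].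
  - destruct (Nat.eq_dec k n) as [->|].
    + rewrite Hp. auto.
    + destruct IHn; [lia|auto|lia].
Qed.

Lemma bfind_none p n : (forall k, k < n -> p k = false) -> bfind p n = n.
Proof.
  induction n; intros H; [reflexivity|]. simpl. rewrite IHn by auto.
  rewrite Nat.ltb_irrefl, H by lia. reflexivity.
Qed.

Lemma computable_bfind p n :
  decidable_by (fun x => p (pfst x) (psnd x)) -> computable n ->
  computable (fun x => bfind (p x) (n x)).
Proof.
  intros Hp Hn.
  apply computable_ext with (fun x => nat_rect (fun _ => nat) 0
    (fun k y => if y <? k then y else if p x k then k else S k) (n x)).
  - intros x. induction (n x); simpl; [reflexivity|]. now rewrite IHn0.
  - apply computable_rec with
      (g := fun x k y => if y <? k then y else if p x k then k else S k); comp.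
    apply computable_if; [comp|comp|]. apply computable_if; [|comp|comp].
    apply (computable_binary (fun x h => Nat.b2n (p x h)) Hp); comp.
Qed.
#[local] Hint Resolve computable_bfind : comp.

(** * Decidable predicates as boolean functions *)

Definition holds (P : Prop) : bool := if excluded_middle_informative P then true else false.

Lemma holds_true P : holds P = true <-> P.
Proof. unfold holds. destruct excluded_middle_informative; split; easy. Qed.

Lemma decides_at_holds c x P : decides_at c x P -> ev c x (Nat.b2n (holds P)).
Proof.
  intros [H1 H0]. unfold holds. destruct excluded_middle_informative; simpl; auto.
Qed.

Lemma decidable_set D : computable_set D -> decidable_by (fun x => holds (D x)).
Proof. intros [c H]. exists c. intros x. now apply decides_at_holds. Qed.

Lemma decidable_guard p c P :
  decidable_by p -> (forall x, p x = true -> decides_at c x (P x)) ->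
  decidable_by (fun x => p x && holds (P x))%bool.
Proof.
  intros Hp Hc. eapply computable_ext; [|apply (computable_guard p c (fun x => Nat.b2n (holds (P x))) Hp)].
  - intros x. cbv beta. now destruct (p x).
  - intros x Hx. now apply decides_at_holds, Hc.
Qed.

(** * Kleene's O *)

Lemma pow2_inj a b : 2 ^ a = 2 ^ b -> a = b.
Proof. apply Nat.pow_inj_r. lia. Qed.

Lemma lim_num_inj e e' : 3 * 5 ^ e = 3 * 5 ^ e' -> e = e'.
Proof. intros H. apply (Nat.pow_inj_r 5); lia. Qed.

Lemma odd_pow5 e : Nat.odd (3 * 5 ^ e) = true.
Proof.
  rewrite Nat.odd_mul. induction e as [|e IH]; [reflexivity|].
  rewrite Nat.pow_succ_r', Nat.odd_mul. exact IH.
Qed.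

Lemma pow2_neq_lim a e : 2 ^ a <> 3 * 5 ^ e.
Proof.
  intros H. pose proof (odd_pow5 e) as E. rewrite <- H in E.
  destruct a as [|a].
  - pose proof (Nat.pow_nonzero 5 e). simpl in H. lia.
  - rewrite Nat.pow_succ_r', Nat.odd_mul in E. discriminate.
Qed.

Lemma lim_neq_1 e : 3 * 5 ^ e <> 1.
Proof. pose proof (Nat.pow_nonzero 5 e). lia. Qed.

Lemma notation_inv_succ a al : notation (2 ^ a) al ->
  (a = 0 /\ al = Ozero) \/ exists be, notation a be /\ al = osucc be.
Proof.
  intros H. remember (2 ^ a) as b eqn:E. destruct H.
  - left. split; [|reflexivity]. now apply pow2_inj.
  - right. apply pow2_inj in E as ->. eauto.
  - destruct (pow2_neq_lim a e). auto.
Qed.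

Lemma notation_nonzero a al : notation a al -> a <> 0.
Proof.
  destruct 1; [easy|apply Nat.pow_nonzero; easy|].
  pose proof (Nat.pow_nonzero 5 e). lia.
Qed.

Lemma notation_1 al : notation 1 al -> al = Ozero.
Proof.
  intros H. destruct (notation_inv_succ 0 al H) as [[_ ->]|(be & Hb & _)]; [easy|].
  now apply notation_nonzero in Hb.
Qed.

Lemma notation_pos a al : notation a al -> a <> 1 -> olt Ozero al.
Proof. destruct 1; intros Ha; [easy|now exists 0|now exists 0]. Qed.

Lemma ltO_succ_inv b a : ltO b (2 ^ a) -> a <> 0 /\ b = a \/ ltO b a.
Proof.
  intros H. remember (2 ^ a) as c eqn:E. destruct H.
  - apply pow2_inj in E as ->. auto.
  - apply pow2_inj in E as ->. auto.
  - destruct (pow2_neq_lim a e). auto.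
Qed.

Lemma ltO_lim_inv b e : ltO b (3 * 5 ^ e) -> exists n c, phi e n c /\ ltO b c.
Proof.
  intros H. remember (3 * 5 ^ e) as d eqn:E. destruct H.
  - now destruct (pow2_neq_lim _ _ E).
  - now destruct (pow2_neq_lim _ _ E).
  - apply lim_num_inj in E as ->. eauto.
Qed.

Lemma not_ltO_0 b : ~ ltO b 0.
Proof.
  intros H. remember 0 as z eqn:E. destruct H.
  - now apply Nat.pow_nonzero in E.
  - now apply Nat.pow_nonzero in E.
  - pose proof (Nat.pow_nonzero 5 e). lia.
Qed.

Lemma not_ltO_1 b : ~ ltO b 1.
Proof.
  intros H. destruct (ltO_succ_inv b 0 H) as [[? _]|H']; [easy|].
  now apply not_ltO_0 in H'.
Qed.

Lemma ltO_notation a al : notation a al -> forall b, ltO b a ->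
  exists be, notation b be /\ olt be al.
Proof.
  induction 1 as [|a al Ha IH|e s al Hs Hlt Hn IH]; intros b Hb.
  - now apply not_ltO_1 in Hb.
  - apply ltO_succ_inv in Hb as [[_ ->]|Hb].
    + exists al. split; [exact Ha|apply olt_osucc].
    + destruct (IH b Hb) as (be & Hbe & Hl). exists be. split; [exact Hbe|].
      eapply olt_trans; [exact Hl|apply olt_osucc].
  - apply ltO_lim_inv in Hb as (n & c & Hc & Hb).
    rewrite (phi_functional _ _ _ _ Hc (Hs n)) in Hb.
    destruct (IH n b Hb) as (be & Hbe & Hl). exists be. split; [exact Hbe|].
    eapply olt_trans; [exact Hl|apply olt_Osup].
Qed.

(** The relation [ltO] is discrete on O; this is what puts the successor of [s n] below the limit
    of [s]. *)
Lemma ltO_succ_le a al : notation a al -> forall b, ltO b a ->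
  2 ^ b = a \/ ltO (2 ^ b) a.
Proof.
  induction 1 as [|a al Ha IH|e s al Hs Hlt Hn IH]; intros b Hb.
  - now apply not_ltO_1 in Hb.
  - apply ltO_succ_inv in Hb as [[_ ->]|Hb]; [auto|].
    right. destruct (IH b Hb) as [E|H].
    + rewrite E. apply ltO_succ. eapply notation_nonzero; eauto.
    + now apply ltO_succ_trans.
  - apply ltO_lim_inv in Hb as (n & c & Hc & Hb). right.
    rewrite (phi_functional _ _ _ _ Hc (Hs n)) in Hb.
    destruct (IH n b Hb) as [E|H].
    + rewrite E. now apply (ltO_lim _ e (S n) (s (S n))).
    + now apply (ltO_lim _ e n (s n)).
Qed.

Lemma ltO_succ_lim e s al n :
  (forall n, phi e n (s n)) -> (forall n, ltO (s n) (s (S n))) ->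
  (forall n, notation (s n) (al n)) -> ltO (2 ^ s n) (3 * 5 ^ e).
Proof.
  intros Hs Hlt Hn.
  destruct (ltO_succ_le _ _ (Hn (S n)) _ (Hlt n)) as [E|H].
  - rewrite E. now apply (ltO_lim _ e (S (S n)) (s (S (S n)))).
  - now apply (ltO_lim _ e (S n) (s (S n))).
Qed.

Lemma notation_unique a al : notation a al -> forall be, notation a be -> ole al be.
Proof.
  induction 1 as [|a al Ha IH|e s al Hs Hlt Hn IH]; intros be Hbe; [exact I| |].
  - destruct (notation_inv_succ _ _ Hbe) as [[-> _]|(be' & Hb & ->)].
    + now apply notation_nonzero in Ha.
    + apply osucc_ole_osucc. auto.
  - remember (3 * 5 ^ e) as d eqn:E. destruct Hbe as [|b be Hb|e' s' be Hs' Hlt' Hn'].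
    + now destruct (lim_neq_1 e).
    + now destruct (pow2_neq_lim b e).
    + apply lim_num_inj in E as ->. intros n. exists n. apply IH.
      rewrite (phi_functional _ _ _ _ (Hs n) (Hs' n)). apply Hn'.
Qed.

Lemma ltO_olt a al b be : notation b be -> notation a al -> ltO b a -> olt be al.
Proof.
  intros Hb Ha H. destruct (ltO_notation a al Ha b H) as (be' & Hb' & Hl).
  eapply ole_olt_trans; [|exact Hl]. eapply notation_unique; eauto.
Qed.

(** Notations exist for an initial segment of the ordinals. *)
Lemma notation_below a al : notation a al -> forall d, ole d al ->
  exists b be, notation b be /\ oeq be d.
Proof.
  induction 1 as [|a al Ha IH|e s al Hs Hlt Hn IH]; intros d Hd.
  - exists 1, Ozero. repeat split; [constructor|exact Hd].
  - destruct (ole_or_olt (osucc al) d) as [H|H].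
    + exists (2 ^ a), (osucc al). repeat split; auto. now constructor.
    + apply IH. now apply olt_osucc_iff.
  - destruct (ole_or_olt (Osup al) d) as [H|[n H]].
    + exists (3 * 5 ^ e), (Osup al). repeat split; auto. econstructor; eauto.
    + eauto.
Qed.

(** * Notations for computable ordinals *)

Definition constn : nat -> nat := nat_rect (fun _ => nat) (npair 0 0)
  (fun _ y => npair 5 (npair (npair 1 0) y)).

Lemma constn_num n : code_num (Const n) = constn n.
Proof. induction n; simpl; [reflexivity|]. now rewrite IHn. Qed.

Lemma computable_constn f : computable f -> computable (fun x => constn (f x)).
Proof.
  apply computable_comp with (f := constn). unfold constn.
  apply computable_rec with (g := fun _ _ y => npair 5 (npair (npair 1 0) y)); comp.
Qed.
#[local] Hint Resolve computable_constn : comp.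

Definition Id : code := PairOf Fst Snd.

Lemma ev_Id x : ev Id x x.
Proof. unfold Id. rewrite <- (npair_eta x) at 2. repeat constructor. Qed.

Definition Curry (c : code) (p : nat) : code := Comp c (PairOf (Const p) Id).

Definition curry_num (e p : nat) : nat :=
  npair 5 (npair e (npair 4 (npair (constn p) (code_num Id)))).

Lemma Curry_num c p : code_num (Curry c p) = curry_num (code_num c) p.
Proof. cbn [code_num Curry]. now rewrite constn_num. Qed.

Lemma ev_Curry c p x y : ev c (npair p x) y -> ev (Curry c p) x y.
Proof. intros H. econstructor; [constructor; [apply ev_Const|apply ev_Id]|exact H]. Qed.

(** [sum_num q a x] is a notation for [a] followed by a sum over the predecessors of [x]: it is the
    limit of the sequence that starts at [a] and at stage [n] appends, if [n] is below [x], the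
    sum for [n], and then one more point.  Passing the start [a] as an argument avoids addition
    of notations; [q] stands for the number of the program of [partial_sum] itself. *)
Section Well_order.
Variable r : nat -> ord.
Variable below : nat -> nat -> bool.
Hypothesis Hdec : decidable_by (fun p => below (pfst p) (psnd p)).
Hypothesis Hr : forall x y, below y x = true -> olt (r y) (r x).
Hypothesis Hrx : forall x b, olt b (r x) -> exists y, below y x = true /\ oeq (r y) b.

Definition sum_num (q a x : nat) : nat := 3 * 5 ^ curry_num q (npair q (npair a x)).

Definition partial_sum (p n : nat) : nat :=
  nat_rect (fun _ => nat) (pfst (psnd p))
    (fun n z => if below n (psnd (psnd p)) then 2 ^ sum_num (pfst p) z n else 2 ^ z) n.

Lemma computable_partial_sum :
  computable (fun x => partial_sum (pfst x) (psnd x)).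
Proof.
  unfold partial_sum. apply computable_rec with (g := fun p n z =>
    if below n (psnd (psnd (pfst p))) then 2 ^ sum_num (pfst (pfst p)) z n else 2 ^ z);
    [comp| |comp].
  unfold sum_num, curry_num. apply computable_if; [|comp|comp].
  apply (computable_binary (fun x h => Nat.b2n (below x h)) Hdec); comp.
Qed.

(** Induction on the rank of [x], for all starting notations [a] at once.  The function
    [partial_sum] is total whatever [below] is; well-foundedness only enters to show that its
    values are in O. *)
Lemma notation_of_well_order x : exists a al, notation a al /\ ole (r x) al.
Proof.
  destruct computable_partial_sum as [Q HQ]. set (q := code_num Q).
  enough (H : forall x a al, notation a al -> exists be,
    notation (sum_num q a x) be /\ ltO a (sum_num q a x) /\ ole (r x) be).
  { destruct (H x 1 Ozero notation_zero) as (be & Hb & _ & Hle). eauto. }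
  clear x. intros x. remember (r x) as rx eqn:Erx. revert x Erx.
  induction rx as [rx IH] using olt_ind. intros x -> a al Ha.
  pose (p := npair q (npair a x)). pose (s := partial_sum p).
  assert (s0 : s 0 = a) by (unfold s, p, partial_sum; simpl; now pairs).
  assert (sS : forall n, s (S n) = if below n x then 2 ^ sum_num q (s n) n else 2 ^ s n)
    by (intros n; unfold s, p, partial_sum; simpl; now pairs).
  assert (Hphi : forall n, phi (curry_num q p) n (s n)).
  { intros n. replace (curry_num q p) with (code_num (Curry Q p)) by apply Curry_num.
    apply phi_code_num, ev_Curry.
    specialize (HQ (npair p n)). revert HQ. now pairs. }
  assert (Hstep : forall n z zl, s n = z -> notation z zl -> exists zl',
     notation (s (S n)) zl' /\ ltO z (s (S n)) /\ (below n x = true -> olt (r n) zl')).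
  { intros n z zl Ez Hz. rewrite sS, Ez. destruct (below n x) eqn:E.
    - destruct (IH _ (Hr x n E) n eq_refl z zl Hz) as (be & Hb & Hlt & Hle).
      exists (osucc be). split; [now constructor|]. split; [now apply ltO_succ_trans|].
      intros _. now apply olt_osucc_iff.
    - exists (osucc zl). split; [now constructor|]. split; [|easy].
      apply ltO_succ. eapply notation_nonzero; eauto. }
  assert (Hnot : forall n, exists zl, notation (s n) zl).
  { induction n as [|n [zl Hz]].
    - rewrite s0. eauto.
    - destruct (Hstep n _ zl eq_refl Hz) as (zl' & H & _). eauto. }
  apply functional_choice in Hnot as [sl Hsl].
  assert (Hlt : forall n, ltO (s n) (s (S n))).
  { intros n. now destruct (Hstep n _ _ eq_refl (Hsl n)) as (? & _ & H & _). }
  exists (Osup sl). unfold sum_num. fold p. split; [|split].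
  - econstructor; eauto.
  - apply ltO_lim with (n := 1) (c := s 1); [apply Hphi|]. rewrite <- s0 at 1. apply Hlt.
  - destruct (ole_or_olt (r x) (Osup sl)) as [H|H]; [exact H|exfalso].
    destruct (Hrx _ _ H) as (n & Hn & Hle).
    destruct (Hstep n _ _ eq_refl (Hsl n)) as (zl & Hz & _ & Hzl).
    specialize (Hzl Hn). apply (olt_irrefl (Osup sl)).
    eapply ole_olt_trans; [apply Hle|]. eapply olt_trans; [exact Hzl|].
    eapply ole_olt_trans; [|apply (olt_Osup sl (S n))].
    eapply notation_unique; [exact Hz|apply Hsl].
Qed.
End Well_order.

(** The well-ordering is shifted by one to make room for 0 as a largest element, whose rank is the
    whole ordinal.  Its decision procedure is guarded, since nothing is known about it outside
    the domain. *)
Lemma computable_ordinal_notation a : computable_ordinal a ->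
  exists n nl, notation n nl /\ ole a nl.
Proof.
  intros (D & R & HD & [c Hc] & _ & r & HrR & Hra & Hsurj).
  pose (RR := fun p => ((holds (D (pfst p)) && holds (D (psnd p)))
    && holds (R (pfst p) (psnd p)))%bool).
  pose (below := fun y x => (negb (y =? 0) && ((x =? 0) && holds (D (pred y))
    || negb (x =? 0) && RR (npair (pred y) (pred x))))%bool).
  pose (rank := fun x => match x with
    | 0 => a
    | S x => if holds (D x) then r x else Ozero
    end).
  apply decidable_set in HD.
  assert (HDf : forall f, computable f -> decidable_by (fun x => holds (D (f x))))
    by (intros f; now apply decidable_comp with (p := fun x => holds (D x))).
  apply (notation_of_well_order rank below) with (x := 0).
  - assert (decidable_by RR).
    { apply decidable_guard with (c := c); [comp|]. intros p Hp.
      apply Bool.andb_true_iff in Hp as [H1 H2].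
      rewrite holds_true in H1. rewrite holds_true in H2.
      rewrite <- (npair_eta p) at 1. auto. }
    assert (forall f, computable f -> decidable_by (fun x => RR (f x)))
      by (intros f; now apply decidable_comp).
    unfold below. comp.
  - intros x y H. unfold below, RR in H.
    destruct y as [|y]; [easy|]. destruct x as [|x]; simpl in H |- *.
    + rewrite Bool.orb_false_r in H. rewrite H. apply Hra. now apply holds_true.
    + rewrite pfst_npair, psnd_npair in H.
      apply Bool.andb_true_iff in H as [H HR].
      apply Bool.andb_true_iff in H as [Hy Hx].
      rewrite Hy, Hx. rewrite holds_true in *. apply HrR; auto.
  - intros x b Hb. destruct x as [|x]; simpl in Hb.
    + destruct (Hsurj b Hb) as (y & Hy & Ey). exists (S y).
      apply holds_true in Hy. unfold below; simpl. now rewrite Hy.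
    + destruct (holds (D x)) eqn:Hx; [|easy].
      assert (Hba : olt b a).
      { eapply olt_trans; [exact Hb|]. apply Hra. now apply holds_true. }
      destruct (Hsurj b Hba) as (y & Hy & Ey). exists (S y).
      assert (HR : R y x).
      { apply HrR; [auto|now apply holds_true|]. eapply ole_olt_trans; [apply Ey|exact Hb]. }
      apply holds_true in Hy. apply holds_true in HR.
      unfold below, RR; simpl. rewrite pfst_npair, psnd_npair. now rewrite Hx, Hy, HR.
Qed.

(** * Infinitary formulas and automorphisms *)

(** A finitary formula has level 0 only, and must be wrapped into a disjunction above. *)
Lemma infinitary_lift {V} (A : structure V) al be n f :
  ole al be -> infinitary V Sigma al n f ->
  exists g, infinitary V Sigma be n g /\ forall v, sat A v g <-> sat A v f.
Proof.
  intros Hle H. remember Sigma as s eqn:Es.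
  destruct H as [s al n q Ha Hq|al n J k F ga Ha Hl HF|]; [| |discriminate].
  - subst s. destruct (ole_or_olt be Ozero) as [Hb|Hb].
    + exists (QF q). split; [|easy]. constructor; [|exact Hq]. now split.
    + exists (Disj (fun i => i = 0) (fun _ => 0) (fun _ => QF q)). split.
      * apply infinitary_Disj with (be := fun _ => Ozero); auto.
        intros i _. rewrite Nat.add_0_r. constructor; [|exact Hq]. now split.
      * intros v. simpl. split.
        -- intros (i & _ & w & Hw & _ & Hs). destruct w; [|discriminate].
           now rewrite app_nil_r in Hs.
        -- intros Hs. exists 0. split; [reflexivity|]. exists [].
           rewrite app_nil_r. auto.
  - exists (Disj J k F). split; [|easy].
    apply infinitary_Disj with ga; [| |exact HF].
    + eapply olt_ole_trans; eauto.
    + intros i Hi. eapply olt_ole_trans; eauto.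
Qed.

Lemma index_infinitary V s a n f i : index_of V s a n f i ->
  forall al, notation a al -> infinitary V s al n f.
Proof.
  assert (Hdown : forall a al (J : nat -> Prop) (b : nat -> nat), notation a al ->
    (forall m, J m -> ltO (b m) a) -> exists be : nat -> ord,
    forall m, J m -> notation (b m) (be m) /\ olt (be m) al).
  { intros a0 al J b Ha Hb.
    apply (functional_choice (fun m be => J m -> notation (b m) be /\ olt be al)).
    intros m. destruct (classic (J m)) as [Hm|Hm].
    - destruct (ltO_notation _ _ Ha _ (Hb m Hm)) as (be & ?). eauto.
    - exists Ozero. easy. }
  induction 1 as [s n q Hq|a n e F b Ha Hb HF IH|a n e F b Ha Hb HF IH]; intros al Hal.
  - apply notation_1 in Hal as ->. constructor; [now split|exact Hq].
  - destruct (Hdown _ _ _ _ Hal Hb) as [be Hbe].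
    apply infinitary_Disj with be.
    + eapply notation_pos; eauto.
    + intros m Hm. now apply Hbe.
    + intros m Hm. apply IH; [exact Hm|]. now apply Hbe.
  - destruct (Hdown _ _ _ _ Hal Hb) as [be Hbe].
    apply infinitary_Conj with be.
    + eapply notation_pos; eauto.
    + intros m Hm. now apply Hbe.
    + intros m Hm. apply IH; [exact Hm|]. now apply Hbe.
Qed.

Lemma term_nested_ind (P : term -> Prop) :
  (forall x, P (Var x)) ->
  (forall s ts, (forall t, In t ts -> P t) -> P (App s ts)) -> forall t, P t.
Proof.
  intros HV HA. fix IH 1. intros [x|s ts]; [apply HV|apply HA].
  induction ts as [|t ts IHts]; [intros _ []|]. intros u [<-|Hu]; [apply IH|now apply IHts].
Qed.

Section Structure.
Context {V : vocabulary} (A : structure V).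

Lemma Forall_nth v x : Forall (dom A) v -> x < length v -> dom A (nth x v 0).
Proof. intros H Hx. rewrite Forall_forall in H. now apply H, nth_In. Qed.

Lemma term_dom v t : Forall (dom A) v -> term_wf V (length v) t -> dom A (term_val A v t).
Proof.
  intros Hv. induction t as [x|s ts IH] using term_nested_ind; intros Ht;
    inversion Ht; subst; simpl.
  - now apply Forall_nth.
  - apply fn_dom; [easy|now rewrite length_map|].
    apply Forall_forall. intros y Hy. apply in_map_iff in Hy as (t & <- & Ht'). auto.
Qed.

Lemma term_aut g v t : automorphism A g -> Forall (dom A) v ->
  term_wf V (length v) t -> term_val A (map g v) t = g (term_val A v t).
Proof.
  intros Hg Hv. induction t as [x|s ts IH] using term_nested_ind; intros Ht;
    inversion Ht; subst; simpl.
  - rewrite nth_indep with (d' := g 0) by now rewrite length_map. apply map_nth.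
  - destruct Hg as (_ & _ & _ & _ & Hf). rewrite Hf; [|easy|now rewrite length_map|].
    + f_equal. rewrite map_map. apply map_ext_in. auto.
    + apply Forall_forall. intros y Hy. apply in_map_iff in Hy as (t & <- & Ht').
      apply term_dom; auto.
Qed.

Lemma terms_aut g v ts : automorphism A g -> Forall (dom A) v ->
  (forall t, In t ts -> term_wf V (length v) t) ->
  map (term_val A (map g v)) ts = map g (map (term_val A v) ts).
Proof.
  intros Hg Hv Hts. rewrite map_map. apply map_ext_in. intros t Ht.
  now apply term_aut; auto.
Qed.

Lemma terms_dom v ts : Forall (dom A) v ->
  (forall t, In t ts -> term_wf V (length v) t) ->
  Forall (dom A) (map (term_val A v) ts).
Proof.
  intros Hv Hts. apply Forall_forall. intros y Hy.
  apply in_map_iff in Hy as (t & <- & Ht'). apply term_dom; auto.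
Qed.

Lemma qsat_aut g v q : automorphism A g -> Forall (dom A) v ->
  qform_wf V (length v) q -> (qsat A (map g v) q <-> qsat A v q).
Proof.
  intros Hg Hv. induction q; simpl; intros Hq.
  - easy.
  - destruct Hq as [Ht Hu]. rewrite !term_aut by easy.
    split; [|congruence]. apply Hg; now apply term_dom.
  - destruct Hq as (Hs & Hl & Hts). rewrite terms_aut by easy. symmetry.
    apply Hg; [easy|now rewrite length_map|now apply terms_dom].
  - now rewrite IHq.
  - now rewrite IHq1, IHq2.
  - now rewrite IHq1, IHq2.
Qed.

Lemma automorphism_preimage g w : automorphism A g -> Forall (dom A) w ->
  exists u, Forall (dom A) u /\ map g u = w.
Proof.
  intros (_ & _ & Hs & _). induction 1 as [|y w Hy Hw (u & Hu & <-)].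
  - now exists [].
  - destruct (Hs y Hy) as (x & Hx & <-). exists (x :: u). auto.
Qed.

Lemma Forall_map_aut g w : automorphism A g -> Forall (dom A) w -> Forall (dom A) (map g w).
Proof.
  intros (Hd & _) Hw. apply Forall_map. eapply Forall_impl; [|exact Hw]. auto.
Qed.

Lemma sat_aut g s be n f : infinitary V s be n f -> automorphism A g ->
  forall v, length v = n -> Forall (dom A) v -> (sat A (map g v) f <-> sat A v f).
Proof.
  intros H Hg. induction H as [s al n q Ha Hq|al n J k F ga Ha Hl HF IH|al n J k F ga Ha Hl HF IH];
    intros v Hn Hv; simpl.
  - subst n. now apply qsat_aut.
  - split; intros (i & Hi & w & Hw & Hd & Hs); exists i; split; auto.
    + destruct (automorphism_preimage g w Hg Hd) as (u & Hu & <-).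
      exists u. rewrite length_map in Hw. repeat split; auto.
      rewrite <- map_app in Hs.
      apply (IH i Hi (v ++ u)); [rewrite length_app; lia|now apply Forall_app|exact Hs].
    + exists (map g w). rewrite length_map. repeat split; auto using Forall_map_aut.
      rewrite <- map_app.
      apply (IH i Hi (v ++ w)); [rewrite length_app; lia|now apply Forall_app|exact Hs].
  - split; intros H i Hi w Hw Hd.
    + specialize (H i Hi (map g w)). rewrite length_map, <- map_app in H.
      apply (IH i Hi (v ++ w)); [rewrite length_app; lia|now apply Forall_app|].
      auto using Forall_map_aut.
    + destruct (automorphism_preimage g w Hg Hd) as (u & Hu & <-).
      rewrite length_map in Hw. rewrite <- map_app.
      apply (IH i Hi (v ++ u)); [rewrite length_app; lia|now apply Forall_app|auto].
Qed.

Lemma sat_orbit s be f xs ys : infinitary V s be (length xs) f -> Forall (dom A) xs ->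
  same_orbit A xs ys -> sat A xs f -> sat A ys f.
Proof.
  intros Hf Hxs (g & Hg & ->) H. eapply sat_aut; eauto.
Qed.

Lemma same_orbit_refl xs : same_orbit A xs xs.
Proof.
  exists (fun x => x). rewrite map_id. split; [|reflexivity].
  repeat split; intros; rewrite ?map_id in *; eauto.
Qed.

(** * Quantifier-free types from literals on variables *)

(** Atoms without nested terms.  They do not determine the quantifier-free type of a tuple, but
    they do once the values of all relevant subterms are among its entries. *)
Definition lit_agree (xs ys : list nat) : Prop :=
  (forall i j, i < length xs -> j < length xs ->
     (nth i xs 0 = nth j xs 0 <-> nth i ys 0 = nth j ys 0)) /\
  (forall s js, is_rel V s -> length js = rel_arity V s ->
     Forall (fun j => j < length xs) js ->
     (rel A s (map (fun j => nth j xs 0) js) <-> rel A s (map (fun j => nth j ys 0) js))) /\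
  (forall s js j, is_fun V s -> length js = fun_arity V s ->
     Forall (fun j => j < length xs) js -> j < length xs ->
     (fn A s (map (fun j => nth j xs 0) js) = nth j xs 0 <->
      fn A s (map (fun j => nth j ys 0) js) = nth j ys 0)).

Fixpoint subvalues (v : list nat) (t : term) : list nat :=
  match t with
  | Var _ => []
  | App s ts => term_val A v (App s ts) :: flat_map (subvalues v) ts
  end.

Lemma subvalues_dom v t : Forall (dom A) v -> term_wf V (length v) t ->
  Forall (dom A) (subvalues v t).
Proof.
  intros Hv. induction t as [x|s ts IH] using term_nested_ind; intros Ht; [constructor|].
  cbn [subvalues]. constructor; [now apply term_dom|].
  inversion Ht; subst. apply Forall_flat_map, Forall_forall. auto.
Qed.

Lemma choose_positions {X} (a b : X -> nat) z z' ts :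
  (forall t, In t ts -> exists j, j < length z /\ a t = nth j z 0 /\ b t = nth j z' 0) ->
  exists js, Forall (fun j => j < length z) js /\ length js = length ts /\
    map a ts = map (fun j => nth j z 0) js /\
    map b ts = map (fun j => nth j z' 0) js.
Proof.
  induction ts as [|t ts IH]; intros H; [exists []; auto|].
  destruct (H t) as (j & Hj & Ea & Eb); [now left|].
  destruct IH as (js & Hjs & Hl & Eas & Ebs); [intros; apply H; now right|].
  exists (j :: js). simpl. rewrite Ea, Eb, Eas, Ebs, Hl. auto.
Qed.

Lemma incl_flat_map {X Y} (f : X -> list Y) l u x :
  incl (flat_map f l) u -> In x l -> incl (f x) u.
Proof. intros H Hx y Hy. apply H, in_flat_map. eauto. Qed.

(** When the entries [u] include all values of subterms, the position of the value of a compound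
    term is expressed by a flat atom, which transfers from [xs ++ u] to [ys ++ v]. *)
Lemma term_named xs ys u v t : length ys = length xs ->
  lit_agree (xs ++ u) (ys ++ v) -> term_wf V (length xs) t ->
  incl (subvalues xs t) u ->
  exists j, j < length (xs ++ u) /\ term_val A xs t = nth j (xs ++ u) 0 /\
    term_val A ys t = nth j (ys ++ v) 0.
Proof.
  intros Hl (Heq & Hrel & Hfn).
  induction t as [x|s ts IH] using term_nested_ind; intros Ht Hu; inversion Ht; subst.
  - exists x. simpl. rewrite !app_nth1, length_app by lia. repeat split. lia.
  - cbn [subvalues] in Hu. apply incl_cons_inv in Hu as [Hu Hus].
    assert (exists js, Forall (fun j => j < length (xs ++ u)) js /\ length js = length ts /\
      map (term_val A xs) ts = map (fun j => nth j (xs ++ u) 0) js /\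
      map (term_val A ys) ts = map (fun j => nth j (ys ++ v) 0) js) as (js & Hj & Hlen & Ex & Ey).
    { apply choose_positions. intros t Hts. apply IH; auto.
      now apply incl_flat_map with ts. }
    apply (In_nth _ _ 0) in Hu as (i & Hi & Ei).
    exists (length xs + i). rewrite length_app, !app_nth2 by lia.
    replace (length xs + i - length xs) with i by lia.
    replace (length xs + i - length ys) with i by lia.
    split; [lia|]. split; [now rewrite Ei|].
    specialize (Hfn s js (length xs + i)).
    rewrite <- Ex, <- Ey, length_app, !app_nth2 in Hfn by lia.
    replace (length xs + i - length xs) with i in Hfn by lia.
    replace (length xs + i - length ys) with i in Hfn by lia.
    apply Hfn; [easy|congruence|now rewrite length_app in Hj|lia|symmetry; exact Ei].
Qed.

Fixpoint qsubvalues (v : list nat) (q : qform) : list nat :=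
  match q with
  | QTrue => []
  | QEq t u => subvalues v t ++ subvalues v u
  | QRel s ts => flat_map (subvalues v) ts
  | QNot q => qsubvalues v q
  | QAnd q r | QOr q r => qsubvalues v q ++ qsubvalues v r
  end.

Lemma qsubvalues_dom v q : Forall (dom A) v -> qform_wf V (length v) q ->
  Forall (dom A) (qsubvalues v q).
Proof.
  intros Hv. induction q; simpl; intros Hq; auto.
  - apply Forall_app. split; apply subvalues_dom; easy.
  - apply Forall_flat_map, Forall_forall. intros t Ht. apply subvalues_dom; [easy|].
    now apply Hq.
  - apply Forall_app. split; [apply IHq1|apply IHq2]; easy.
  - apply Forall_app. split; [apply IHq1|apply IHq2]; easy.
Qed.

Lemma qsat_lit_agree xs ys u v q : length ys = length xs ->
  lit_agree (xs ++ u) (ys ++ v) -> qform_wf V (length xs) q ->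
  incl (qsubvalues xs q) u -> (qsat A xs q <-> qsat A ys q).
Proof.
  intros Hl HL. induction q; simpl; intros Hq Hu; try apply incl_app_inv in Hu as [Hu1 Hu2].
  - easy.
  - destruct Hq as [Ht Ht'].
    destruct (term_named xs ys u v t) as (i & Hi & -> & ->); auto.
    destruct (term_named xs ys u v u0) as (j & Hj & -> & ->); auto.
    now apply HL.
  - destruct Hq as (Hs & Hlen & Hts).
    destruct (choose_positions (term_val A xs) (term_val A ys) (xs ++ u) (ys ++ v) ts)
      as (js & Hj & Hl' & -> & ->).
    { intros t Ht. apply term_named; auto. now apply incl_flat_map with ts. }
    apply HL; auto. congruence.
  - now rewrite IHq.
  - now rewrite IHq1, IHq2.
  - now rewrite IHq1, IHq2.
Qed.
End Structure.

(** * Computable formulas with a given index *)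

Lemma map_inj_in {X Y} (f : X -> Y) l : forall l',
  (forall x, In x l -> forall y, f x = f y -> x = y) -> map f l = map f l' -> l = l'.
Proof.
  induction l as [|x l IH]; intros [|y l'] H E; try discriminate; [reflexivity|].
  injection E as E1 E2. f_equal; [apply H; simpl; auto|apply IH; auto with datatypes].
Qed.

Lemma list_num_inj l l' : list_num l = list_num l' -> l = l'.
Proof. intros H. now rewrite <- (lst_list_num l), H, lst_list_num. Qed.

Lemma term_num_inj t : forall t', term_num t = term_num t' -> t = t'.
Proof.
  induction t as [x|s ts IH] using term_nested_ind; intros [x'|s' ts'] H; simpl in H;
    apply npair_inj in H as [H1 H2]; try discriminate.
  - congruence.
  - apply npair_inj in H2 as [-> H2]. apply list_num_inj in H2.
    f_equal. eapply map_inj_in; eauto.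
Qed.

Lemma qform_num_inj q : forall q', qform_num q = qform_num q' -> q = q'.
Proof.
  induction q; intros [] H; simpl in H; apply npair_inj in H as [H1 H2];
    try discriminate; try apply npair_inj in H2 as [H2 H3]; f_equal;
    auto using term_num_inj.
  apply list_num_inj in H3. eapply map_inj_in; [|exact H3].
  intros ? _ ?. apply term_num_inj.
Qed.

(** The levels may differ: below the top, the choice of the levels [b] in [index_of] is not part
    of the index. *)
Lemma index_determines {V} (A : structure V) s a n f i : index_of V s a n f i ->
  forall a' f', index_of V s a' n f' i -> forall v, sat A v f <-> sat A v f'.
Proof.
  induction 1 as [s n q Hq|a n e F b Ha Hb HF IH|a n e F b Ha Hb HF IH];
    intros a' f' H' v.
  - remember (npair 2 (qform_num q)) as i eqn:E.
    destruct H'; apply npair_inj in E as [E1 E2]; try discriminate.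
    apply qform_num_inj in E2 as ->. easy.
  - remember (npair 0 (npair a (npair n e))) as i eqn:E.
    destruct H' as [|a' n e' F' b' Ha' Hb' HF'|];
      apply npair_inj in E as [E1 E2]; try discriminate.
    apply npair_inj in E2 as [_ E2]. apply npair_inj in E2 as [_ ->]. simpl.
    split; intros (m & Hm & w & Hw & Hd & Hs);
      apply (IH m Hm _ _ (HF' m Hm)) in Hs; eauto 6.
  - remember (npair 1 (npair a (npair n e))) as i eqn:E.
    destruct H' as [| |a' n e' F' b' Ha' Hb' HF'];
      apply npair_inj in E as [E1 E2]; try discriminate.
    apply npair_inj in E2 as [_ E2]. apply npair_inj in E2 as [_ ->]. simpl.
    split; intros H m Hm w Hw Hd; apply (IH m Hm _ _ (HF' m Hm)); auto.
Qed.

(** The index only determines a formula up to equivalence, so different [k] with the same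
    element of [W e] may carry different formulas: the family picks one of them, and
    [index_determines] makes the choice harmless. *)
Lemma choose_family {V} (A : structure V) s a n e (K I lev : nat -> nat) (f : nat -> form) :
  (forall m, W e m <-> exists k, m = npair (K k) (I k)) ->
  (forall k, ltO (lev k) a) ->
  (forall k, index_of V s (lev k) (n + K k) (f k) (I k)) ->
  exists (F : nat -> form) (b : nat -> nat),
    (forall m, W e m -> ltO (b m) a) /\
    (forall m, W e m -> index_of V s (b m) (n + pfst m) (F m) (psnd m)) /\
    (forall k v, sat A v (F (npair (K k) (I k))) <-> sat A v (f k)).
Proof.
  intros HW Hlev Hf.
  destruct (functional_choice (fun m k => W e m -> m = npair (K k) (I k))) as [k Hk].
  { intros m. destruct (classic (W e m)) as [H|H]; [|exists 0; easy].
    apply HW in H as [k ->]. eauto. }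
  assert (HF : forall m, W e m ->
    index_of V s (lev (k m)) (n + pfst m) (f (k m)) (psnd m)).
  { intros m Hm. specialize (Hf (k m)). specialize (Hk m Hm).
    pose proof (f_equal pfst Hk) as E1. pose proof (f_equal psnd Hk) as E2.
    rewrite pfst_npair in E1. rewrite psnd_npair in E2. now rewrite E1, E2. }
  exists (fun m => f (k m)), (fun m => lev (k m)). repeat split; auto.
  - intros H. assert (Hm : W e (npair (K k0) (I k0))) by (apply HW; eauto).
    specialize (HF _ Hm). revert HF. pairs. intros HF.
    now apply (index_determines A _ _ _ _ _ HF _ _ (Hf k0)).
  - intros H. assert (Hm : W e (npair (K k0) (I k0))) by (apply HW; eauto).
    specialize (HF _ Hm). revert HF. pairs. intros HF.
    now apply (index_determines A _ _ _ _ _ HF _ _ (Hf k0)).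
Qed.

Lemma index_Disj_range {V} (A : structure V) a n e (K I lev : nat -> nat) (f : nat -> form) :
  a <> 1 ->
  (forall m, W e m <-> exists k, m = npair (K k) (I k)) ->
  (forall k, ltO (lev k) a) ->
  (forall k, index_of V Pi (lev k) (n + K k) (f k) (I k)) ->
  exists g, index_of V Sigma a n g (npair 0 (npair a (npair n e))) /\
    forall v, sat A v g <-> exists k w, length w = K k /\ Forall (dom A) w /\
      sat A (v ++ w) (f k).
Proof.
  intros Ha HW Hlev Hf.
  destruct (choose_family A _ _ _ _ _ _ _ _ HW Hlev Hf) as (F & b & Hb & HF & HE).
  exists (Disj (W e) pfst F). split; [econstructor; eauto|].
  intros v. simpl. split.
  - intros (m & Hm & w & Hw & Hd & Hs). apply HW in Hm as [k ->].
    exists k, w. revert Hw. pairs. intros Hw. repeat split; auto. now apply HE.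
  - intros (k & w & Hw & Hd & Hs). exists (npair (K k) (I k)). split; [apply HW; eauto|].
    exists w. pairs. repeat split; auto. now apply HE.
Qed.

Lemma index_Conj_range {V} (A : structure V) a n e (K I lev : nat -> nat) (f : nat -> form) :
  a <> 1 ->
  (forall m, W e m <-> exists k, m = npair (K k) (I k)) ->
  (forall k, ltO (lev k) a) ->
  (forall k, index_of V Sigma (lev k) (n + K k) (f k) (I k)) ->
  exists g, index_of V Pi a n g (npair 1 (npair a (npair n e))) /\
    forall v, sat A v g <-> forall k w, length w = K k -> Forall (dom A) w ->
      sat A (v ++ w) (f k).
Proof.
  intros Ha HW Hlev Hf.
  destruct (choose_family A _ _ _ _ _ _ _ _ HW Hlev Hf) as (F & b & Hb & HF & HE).
  exists (Conj (W e) pfst F). split; [econstructor; eauto|].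
  intros v. simpl. split.
  - intros H k w Hw Hd. apply HE. apply H; pairs; auto. apply HW; eauto.
  - intros H m Hm w Hw Hd. apply HW in Hm as [k ->]. revert Hw. pairs. intros Hw.
    apply HE. auto.
Qed.

(** * Programs for c.e. sets *)

Definition Range (T c : code) (p : nat) : code :=
  Mu (Comp T (PairOf (PairOf (Const p) (Comp c Snd)) Fst)).

Definition range_num (t e p : nat) : nat :=
  npair 7 (npair 5 (npair t (npair 4 (npair
    (npair 4 (npair (constn p) (npair 5 (npair e (code_num Snd))))) (code_num Fst))))).

Lemma Range_num T c p : code_num (Range T c p) = range_num (code_num T) (code_num c) p.
Proof. cbn [code_num Range]. now rewrite constn_num. Qed.

Lemma computable_range_num f g h : computable f -> computable g -> computable h ->
  computable (fun x => range_num (f x) (g x) (h x)).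
Proof. intros. unfold range_num. comp. Qed.
#[local] Hint Resolve computable_range_num : comp.

(** On input [m] the program searches for [k] with [G p (phi_e k) = m].  The program with number [e]
    occurs in it as a subterm, so no interpreter of programs is involved, and its number is an
    arithmetical function of [e] and [p]. *)
Lemma range_template (G : nat -> nat -> nat) :
  computable (fun x => G (pfst x) (psnd x)) ->
  exists T, forall e p s, (forall k, phi e k (s k)) ->
    forall m, W (range_num (code_num T) e p) m <-> exists k, m = G p (s k).
Proof.
  intros HG.
  destruct (computable_if (fun x => psnd x =? G (pfst (pfst x)) (psnd (pfst x)))
    (fun _ => 0) (fun _ => 1)) as [T HT]; [|comp..|].
  { apply decidable_eqb; [comp|]. apply (computable_binary G HG); comp. }
  exists T. intros e p s Hs m.
  destruct (Hs 0) as (c & <- & _). rewrite <- Range_num.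
  assert (Hc : forall k, ev c k (s k)) by (intros k; now apply phi_code_num).
  assert (Hbody : forall k, ev (Comp T (PairOf (PairOf (Const p) (Comp c Snd)) Fst))
    (npair m k) (if m =? G p (s k) then 0 else 1)).
  { intros k. specialize (HT (npair (npair p (s k)) m)). revert HT. pairs. intros HT.
    econstructor; [|exact HT].
    rewrite <- (pfst_npair m k) at 2.
    constructor; [|constructor]. constructor; [apply ev_Const|].
    econstructor; [constructor|]. now rewrite psnd_npair. }
  unfold W. split.
  - intros (y & H). apply phi_code_num in H.
    inversion H as [| | | | | | | |? ? ? Hlow H0]; subst.
    exists y. specialize (Hbody y). destruct (Nat.eqb_spec m (G p (s y))); [easy|].
    discriminate (ev_functional _ _ _ _ H0 Hbody).
  - intros (k & ->).
    induction k as [k IH] using lt_wf_ind.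
    destruct (classic (exists j, j < k /\ G p (s k) = G p (s j))) as [(j & Hj & E)|Hno].
    + rewrite E in *. now apply (IH j).
    + exists k. apply phi_code_num. constructor.
      * intros j Hj. exists 0. specialize (Hbody j).
        destruct (Nat.eqb_spec (G p (s k)) (G p (s j))) as [E|_]; [|exact Hbody].
        destruct Hno. eauto.
      * specialize (Hbody k). now rewrite Nat.eqb_refl in Hbody.
Qed.

Definition id_num : nat := code_num Id.
Lemma phi_id k : phi id_num k k.
Proof. apply phi_code_num, ev_Id. Qed.

(** * Indices of Scott formulas *)

Section Back_and_forth.
Local Open Scope bool_scope.
Context {V : vocabulary} (A : structure V).

Definition total_arity (sym : nat -> Prop) (ar : nat -> nat) (s : nat) : nat :=
  if holds (sym s) then ar s else 0.

Definition args_ok (sym : nat -> Prop) (ar : nat -> nat) (p : nat -> bool)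
    (s : nat) (xs : list nat) : bool :=
  holds (sym s) && (length xs =? total_arity sym ar s) && forallb p xs.

Lemma args_ok_true sym ar (p : nat -> bool) (P : nat -> Prop) s xs :
  (forall x, p x = true <-> P x) ->
  (args_ok sym ar p s xs = true <-> sym s /\ length xs = ar s /\ Forall P xs).
Proof.
  intros Hp. unfold args_ok, total_arity.
  rewrite !Bool.andb_true_iff, holds_true, Nat.eqb_eq, forallb_forall, Forall_forall.
  setoid_rewrite Hp. split.
  - intros [[H1 H2] H3]. apply holds_true in H1 as H. rewrite H in H2. auto.
  - intros (H1 & H2 & H3). apply holds_true in H1 as H. rewrite H. auto.
Qed.

Definition rel_ok (n : nat) : nat -> list nat -> bool :=
  args_ok (is_rel V) (rel_arity V) (fun j => j <? n).
Definition fun_ok (n : nat) : nat -> list nat -> bool :=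
  args_ok (is_fun V) (fun_arity V) (fun j => j <? n).

(** [kind] selects equalities between variables, relations, and graphs of functions; arguments
    that do not form an atom in [n] variables give [QTrue], so that all numbers may be used. *)
Definition atom (n kind s : nat) (js : list nat) (j : nat) : qform :=
  if kind =? 0 then
    if (s <? n) && (j <? n) then QEq (Var s) (Var j) else QTrue
  else if kind =? 1 then
    if rel_ok n s js then QRel s (map Var js) else QTrue
  else
    if fun_ok n s js && (j <? n) then QEq (App s (map Var js)) (Var j) else QTrue.

Definition literal (t : list nat) (kind s : nat) (js : list nat) (j : nat) : qform :=
  let q := atom (length t) kind s js j in if holds (qsat A t q) then q else QNot q.

Lemma rel_ok_true n s js : rel_ok n s js = true <->
  is_rel V s /\ length js = rel_arity V s /\ Forall (fun j => j < n) js.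
Proof. apply args_ok_true. intros x. apply Nat.ltb_lt. Qed.

Lemma fun_ok_true n s js : fun_ok n s js = true <->
  is_fun V s /\ length js = fun_arity V s /\ Forall (fun j => j < n) js.
Proof. apply args_ok_true. intros x. apply Nat.ltb_lt. Qed.

Lemma vars_wf n js : Forall (fun j => j < n) js ->
  forall t, In t (map Var js) -> term_wf V n t.
Proof.
  intros H t Ht. apply in_map_iff in Ht as (j & <- & Hj).
  constructor. rewrite Forall_forall in H. auto.
Qed.

Lemma atom_wf n kind s js j : qform_wf V n (atom n kind s js j).
Proof.
  unfold atom. destruct (kind =? 0), (kind =? 1).
  1-2: destruct (Nat.ltb_spec s n), (Nat.ltb_spec j n); simpl; auto using term_wf_Var.
  - destruct (rel_ok n s js) eqn:E; [|exact I]. apply rel_ok_true in E as (H1 & H2 & H3).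
    simpl. rewrite length_map. repeat split; auto. now apply vars_wf.
  - destruct (fun_ok n s js) eqn:E; [|exact I]. apply fun_ok_true in E as (H1 & H2 & H3).
    destruct (Nat.ltb_spec j n); simpl; [|exact I].
    split; [|now constructor]. constructor; [easy|now rewrite length_map|].
    now apply vars_wf.
Qed.

Lemma literal_wf t kind s js j : qform_wf V (length t) (literal t kind s js j).
Proof.
  unfold literal. destruct (holds _); simpl; apply atom_wf.
Qed.

Lemma literal_true t kind s js j : qsat A t (literal t kind s js j).
Proof.
  unfold literal. destruct (holds _) eqn:E; simpl.
  - now apply holds_true.
  - intros H. apply holds_true in H. congruence.
Qed.

Lemma literals_agree t ys :
  (forall kind s js j, qsat A ys (literal t kind s js j)) -> lit_agree A t ys.
Proof.
  intros H.
  assert (Hq : forall kind s js j, qsat A t (atom (length t) kind s js j) <->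
    qsat A ys (atom (length t) kind s js j)).
  { intros kind s js j. specialize (H kind s js j). unfold literal in H. cbv zeta in H.
    destruct (holds _) eqn:E.
    - rewrite holds_true in E. now split.
    - split; intros H'; [|now destruct (H H')].
      apply holds_true in H'. congruence. }
  clear H. split; [|split].
  - intros i j Hi Hj. specialize (Hq 0 i [] j). unfold atom in Hq. simpl in Hq.
    apply Nat.ltb_lt in Hi. apply Nat.ltb_lt in Hj. now rewrite Hi, Hj in Hq.
  - intros s js Hs Hl Hjs. specialize (Hq 1 s js 0). unfold atom in Hq. simpl in Hq.
    assert (E : rel_ok (length t) s js = true) by now apply rel_ok_true.
    rewrite E in Hq. simpl in Hq. now rewrite !map_map in Hq.
  - intros s js j Hs Hl Hjs Hj. specialize (Hq 2 s js j). unfold atom in Hq. simpl in Hq.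
    assert (E : fun_ok (length t) s js = true) by now apply fun_ok_true.
    apply Nat.ltb_lt in Hj. rewrite E, Hj in Hq. simpl in Hq. now rewrite !map_map in Hq.
Qed.

(** Data for [enumerator]: the number [tau] of the program that will compute it, the kind of set
    to enumerate, and the remaining parameters. *)
Definition param (tau kind rest : nat) : nat := npair tau (npair kind rest).

(** Sigma index at level [2 ^ c] in [n] variables, over a set of kind 2 or 3: [EX y phi_{td,c}(xy)]
    for kind 2, and the disjunction of the [phi_{td',c}] with [d'] as long as [d] for kind 3. *)
Definition wrap_num (tau kind t c d n : nat) : nat :=
  npair 0 (npair (2 ^ c) (npair n
    (range_num tau id_num (param tau kind (npair t (npair c d)))))).

(** The number [e] when [b] is [3 * 5 ^ e] or its successor in O, and [b] itself when [b] has
    neither form. *)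
Definition lim_exponent (b : nat) : nat :=
  bfind (fun e => (b =? 3 * 5 ^ e) || (b =? 2 ^ (3 * 5 ^ e))) b.
Definition step_exponent (b : nat) : nat := bfind (fun c => b =? 2 ^ 2 ^ c) b.

(** The notations 2 and 4 carry the literals, as the formula for the notation 1 says nothing and a
    back-and-forth step over it would be worthless.  The successor of a limit repeats the limit:
    steps are taken only at notations of the form [2 ^ 2 ^ c], which leaves a level free for the
    disjunctions between two stages. *)
Definition scott_set_num (tau t b : nat) : nat :=
  if (b =? 2) || (b =? 4) then range_num tau id_num (param tau 0 t)
  else if lim_exponent b <? b then range_num tau (lim_exponent b) (param tau 4 t)
  else range_num tau id_num (param tau 1 (npair t (step_exponent b))).

Definition scott_num (tau t b : nat) : nat :=
  if b =? 1 then npair 2 (qform_num QTrue)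
  else npair 1 (npair b (npair (length (lst t)) (scott_set_num tau t b))).

(** [clean] and [fit] replace lists that are not tuples of the required kind by default ones, so
    that numbers enumerate exactly the tuples, respectively those as long as [d]. *)
Definition clean (u : list nat) : list nat :=
  if forallb (fun x => holds (dom A x)) u then u else [].

Definition fit (d v : list nat) : list nat :=
  if forallb (fun x => holds (dom A x)) v && (length v =? length d) then v else d.

Definition literal_entry (t v : nat) : nat :=
  npair 0 (npair 2 (qform_num (literal (clean (lst t)) (pfst v) (pfst (psnd v))
    (lst (pfst (psnd (psnd v)))) (psnd (psnd (psnd v)))))).

(** Enumerates both halves of a back-and-forth step, for every tuple [u]. *)
Definition step_entry (tau t c v : nat) : nat :=
  let u := clean (lst (psnd v)) in
  if pfst v =? 0 then npair 0 (wrap_num tau 2 t c (list_num u) (length (lst t)))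
  else npair (length u) (wrap_num tau 3 t c (list_num u) (length (lst t) + length u)).

Definition forth_entry (tau t c d : nat) : nat :=
  npair (length (lst d)) (scott_num tau (list_num (lst t ++ lst d)) c).

Definition back_entry (tau t c d v : nat) : nat :=
  npair 0 (scott_num tau (list_num (lst t ++ fit (lst d) (lst v))) c).

Definition limit_entry (tau t v : nat) : nat :=
  npair 0 (wrap_num tau 2 t v 0 (length (lst t))).

Definition enumerator (p v : nat) : nat :=
  let tau := pfst p in let kind := pfst (psnd p) in let rest := psnd (psnd p) in
  if kind =? 0 then literal_entry rest v
  else if kind =? 1 then step_entry tau (pfst rest) (psnd rest) v
  else if kind =? 2 then
    forth_entry tau (pfst rest) (pfst (psnd rest)) (psnd (psnd rest))
  else if kind =? 3 then
    back_entry tau (pfst rest) (pfst (psnd rest)) (psnd (psnd rest)) v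
  else limit_entry tau rest v.

Lemma computable_scott_num f g h :
  computable f -> computable g -> computable h ->
  computable (fun x => scott_num (f x) (g x) (h x)).
Proof.
  intros Hf Hg Hh.
  assert (H1 : forall k, computable k -> computable (fun x => lim_exponent (k x)))
    by (intros k Hk; unfold lim_exponent; comp).
  assert (H2 : forall k, computable k -> computable (fun x => step_exponent (k x)))
    by (intros k Hk; unfold step_exponent; comp).
  unfold scott_num, scott_set_num, param. comp.
Qed.

Lemma computable_wrap_num f kind g h i j :
  computable f -> computable g -> computable h -> computable i -> computable j ->
  computable (fun x => wrap_num (f x) kind (g x) (h x) (i x) (j x)).
Proof. intros. unfold wrap_num, param. comp. Qed.

Context (HV : computable_vocabulary V) (HA : computable_structure A).

Lemma decidable_dom f : computable f -> decidable_by (fun x => holds (dom A (f x))).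
Proof.
  destruct HA as (H & _). apply decidable_set in H.
  now apply decidable_comp with (p := fun x => holds (dom A x)).
Qed.

Lemma decidable_is_rel f : computable f -> decidable_by (fun x => holds (is_rel V (f x))).
Proof.
  destruct HV as (H & _). apply decidable_set in H.
  now apply decidable_comp with (p := fun x => holds (is_rel V x)).
Qed.

Lemma decidable_is_fun f : computable f -> decidable_by (fun x => holds (is_fun V (f x))).
Proof.
  destruct HV as (_ & _ & H & _). apply decidable_set in H.
  now apply decidable_comp with (p := fun x => holds (is_fun V x)).
Qed.
#[local] Hint Resolve decidable_dom decidable_is_rel decidable_is_fun computable_scott_num
  computable_wrap_num : comp.

(** The arity is only computable on symbols, whence the default value. *)
Lemma computable_total_arity sym ar f :
  (forall g, computable g -> decidable_by (fun x => holds (sym (g x)))) ->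
  (exists c, forall s, sym s -> ev c s (ar s)) ->
  computable f -> computable (fun x => total_arity sym ar (f x)).
Proof.
  intros Hsym [c Hc]. apply computable_comp with (f := total_arity sym ar).
  apply computable_guard with c; [apply Hsym; comp|].
  intros x Hx. apply Hc. now apply holds_true.
Qed.

Lemma computable_total_rel_arity f : computable f ->
  computable (fun x => total_arity (is_rel V) (rel_arity V) (f x)).
Proof. apply computable_total_arity; [exact decidable_is_rel|apply HV]. Qed.

Lemma computable_total_fun_arity f : computable f ->
  computable (fun x => total_arity (is_fun V) (fun_arity V) (f x)).
Proof. apply computable_total_arity; [exact decidable_is_fun|apply HV]. Qed.
#[local] Hint Resolve computable_total_rel_arity computable_total_fun_arity : comp.

Lemma decidable_rel_ok n s js : computable n -> computable s -> computable js ->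
  decidable_by (fun x => rel_ok (n x) (s x) (lst (js x))).
Proof. intros. unfold rel_ok, args_ok. comp. Qed.

Lemma decidable_fun_ok n s js : computable n -> computable s -> computable js ->
  decidable_by (fun x => fun_ok (n x) (s x) (lst (js x))).
Proof. intros. unfold fun_ok, args_ok. comp. Qed.
#[local] Hint Resolve decidable_rel_ok decidable_fun_ok : comp.

Definition rel_args_ok : nat -> list nat -> bool :=
  args_ok (is_rel V) (rel_arity V) (fun x => holds (dom A x)).
Definition fun_args_ok : nat -> list nat -> bool :=
  args_ok (is_fun V) (fun_arity V) (fun x => holds (dom A x)).

Definition decide_rel (s : nat) (xs : list nat) : bool :=
  (rel_args_ok s xs && holds (rel A s xs)).
Definition total_fn (s : nat) (xs : list nat) : nat :=
  if fun_args_ok s xs then fn A s xs else 0.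

Lemma forallb_dom xs : forallb (fun x => holds (dom A x)) xs = true <-> Forall (dom A) xs.
Proof.
  rewrite forallb_forall, Forall_forall. split; intros H x Hx; apply holds_true; auto.
Qed.

Lemma rel_args_ok_true s xs : rel_args_ok s xs = true <->
  is_rel V s /\ length xs = rel_arity V s /\ Forall (dom A) xs.
Proof. apply args_ok_true. intros x. apply holds_true. Qed.

Lemma fun_args_ok_true s xs : fun_args_ok s xs = true <->
  is_fun V s /\ length xs = fun_arity V s /\ Forall (dom A) xs.
Proof. apply args_ok_true. intros x. apply holds_true. Qed.

Lemma decidable_decide_rel s xs : computable s -> computable xs ->
  decidable_by (fun x => decide_rel (s x) (lst (xs x))).
Proof.
  intros Hs Hxs. destruct HA as (_ & [c Hc] & _).
  destruct (decidable_guard (fun x => rel_args_ok (pfst x) (lst (psnd x))) c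
    (fun x => rel A (pfst x) (lst (psnd x)))) as [d Hd].
  - unfold rel_args_ok, args_ok. comp.
  - intros x Hx. apply rel_args_ok_true in Hx as (H1 & H2 & H3).
    specialize (Hc _ _ H1 H2 H3). now rewrite list_num_lst, npair_eta in Hc.
  - apply (computable_binary (fun s xs => Nat.b2n (decide_rel s (lst xs)))); [|comp|comp].
    now exists d.
Qed.

Lemma computable_total_fn s xs : computable s -> computable xs ->
  computable (fun x => total_fn (s x) (lst (xs x))).
Proof.
  intros Hs Hxs. destruct HA as (_ & _ & [c Hc]).
  destruct (computable_guard (fun x => fun_args_ok (pfst x) (lst (psnd x))) c
    (fun x => fn A (pfst x) (lst (psnd x)))) as [d Hd].
  - unfold fun_args_ok, args_ok. comp.
  - intros x Hx. apply fun_args_ok_true in Hx as (H1 & H2 & H3).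
    specialize (Hc _ _ H1 H2 H3). now rewrite list_num_lst, npair_eta in Hc.
  - apply (computable_binary (fun s xs => total_fn s (lst xs))); [|comp|comp].
    now exists d.
Qed.
#[local] Hint Resolve decidable_decide_rel computable_total_fn : comp.

Definition values (t js : list nat) : list nat := map (fun j => nth j t 0) js.

(** Truth of atoms through the total versions of the relations and functions; this is correct
    because the test [rel_ok] or [fun_ok] ensures that they are applied within the structure. *)
Definition decide_atom (t : list nat) (kind s : nat) (js : list nat) (j : nat) : bool :=
  let n := length t in
  if kind =? 0 then if (s <? n) && (j <? n) then nth s t 0 =? nth j t 0 else true
  else if kind =? 1 then if rel_ok n s js then decide_rel s (values t js) else true
  else if fun_ok n s js && (j <? n) then total_fn s (values t js) =? nth j t 0 else true.

Lemma values_dom t js : Forall (dom A) t -> Forall (fun j => j < length t) js ->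
  Forall (dom A) (values t js).
Proof.
  intros Ht Hj. apply Forall_map. eapply Forall_impl; [|exact Hj].
  intros j. now apply Forall_nth.
Qed.

Lemma decide_atom_correct t kind s js j : Forall (dom A) t ->
  decide_atom t kind s js j = holds (qsat A t (atom (length t) kind s js j)).
Proof.
  intros Ht. apply Bool.eq_iff_eq_true. rewrite holds_true.
  unfold decide_atom, atom. destruct (kind =? 0); [|destruct (kind =? 1)].
  - destruct ((s <? length t) && (j <? length t)); [|easy]. apply Nat.eqb_eq.
  - destruct (rel_ok _ _ _) eqn:E; [|easy].
    apply rel_ok_true in E as (H1 & H2 & H3). simpl. rewrite map_map.
    unfold decide_rel.
    assert (H : rel_args_ok s (values t js) = true).
    { apply rel_args_ok_true. unfold values at 1. rewrite length_map.
      auto using values_dom. }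
    rewrite H. apply holds_true.
  - destruct (fun_ok _ _ _ && _) eqn:E; [|easy].
    apply Bool.andb_true_iff in E as [E _].
    apply fun_ok_true in E as (H1 & H2 & H3). simpl. rewrite map_map.
    unfold total_fn.
    assert (H : fun_args_ok s (values t js) = true).
    { apply fun_args_ok_true. unfold values at 1. rewrite length_map.
      auto using values_dom. }
    rewrite H. apply Nat.eqb_eq.
Qed.

Lemma clean_dom u : Forall (dom A) (clean u).
Proof.
  unfold clean. destruct (forallb _ u) eqn:E; [|constructor]. now apply forallb_dom.
Qed.

Lemma clean_id u : Forall (dom A) u -> clean u = u.
Proof. intros H. unfold clean. apply forallb_dom in H. now rewrite H. Qed.

Definition atom_num (n kind s js j : nat) : nat :=
  let vars := list_num (map (npair 0) (lst js)) in
  if kind =? 0 then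
    if (s <? n) && (j <? n) then npair 1 (npair (npair 0 s) (npair 0 j)) else qform_num QTrue
  else if kind =? 1 then
    if rel_ok n s (lst js) then npair 2 (npair s vars) else qform_num QTrue
  else
    if fun_ok n s (lst js) && (j <? n)
    then npair 1 (npair (npair 1 (npair s vars)) (npair 0 j)) else qform_num QTrue.

Lemma atom_num_correct n kind s js j :
  qform_num (atom n kind s (lst js) j) = atom_num n kind s js j.
Proof.
  unfold atom, atom_num.
  destruct (kind =? 0); [|destruct (kind =? 1)];
    match goal with |- context [if ?b then _ else _] => destruct b end; try reflexivity;
    cbn [qform_num term_num]; now rewrite map_map.
Qed.

Lemma computable_clean f : computable f -> computable (fun x => list_num (clean (lst (f x)))).
Proof.
  intros Hf.
  apply computable_ext with (fun x => if forallb (fun y => holds (dom A y)) (lst (f x))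
    then f x else 0); [|comp].
  intros x. unfold clean. destruct (forallb _ _); [now rewrite list_num_lst|reflexivity].
Qed.

Lemma computable_fit f g : computable f -> computable g ->
  computable (fun x => list_num (fit (lst (f x)) (lst (g x)))).
Proof.
  intros Hf Hg.
  apply computable_ext with (fun x => if forallb (fun y => holds (dom A y)) (lst (g x))
    && (length (lst (g x)) =? length (lst (f x))) then g x else f x); [|comp].
  intros x. unfold fit. destruct (_ && _); now rewrite list_num_lst.
Qed.

Lemma decidable_decide_atom t kind s js j :
  computable t -> computable kind -> computable s -> computable js -> computable j ->
  decidable_by (fun x => decide_atom (lst (t x)) (kind x) (s x) (lst (js x)) (j x)).
Proof.
  intros Ht Hk Hs Hjs Hj.
  pose (vals := fun x => list_num (map (fun i => nth i (lst (t x)) 0) (lst (js x)))).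
  assert (Hv : computable vals) by (unfold vals; comp).
  apply decidable_ext with (fun x =>
    if kind x =? 0 then
      if (s x <? length (lst (t x))) && (j x <? length (lst (t x)))
      then nth (s x) (lst (t x)) 0 =? nth (j x) (lst (t x)) 0 else true
    else if kind x =? 1 then
      if rel_ok (length (lst (t x))) (s x) (lst (js x))
      then decide_rel (s x) (lst (vals x)) else true
    else
      if fun_ok (length (lst (t x))) (s x) (lst (js x)) && (j x <? length (lst (t x)))
      then total_fn (s x) (lst (vals x)) =? nth (j x) (lst (t x)) 0 else true).
  { intros x. unfold vals. rewrite lst_list_num. reflexivity. }
  comp.
Qed.

Lemma computable_literal t kind s js j :
  computable t -> computable kind -> computable s -> computable js -> computable j ->
  computable (fun x => qform_num
    (literal (clean (lst (t x))) (kind x) (s x) (lst (js x)) (j x))).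
Proof.
  intros Ht Hk Hs Hjs Hj. pose proof (computable_clean t Ht) as Hc.
  set (t' := fun x => list_num (clean (lst (t x)))) in Hc.
  apply computable_ext with (fun x =>
    if decide_atom (lst (t' x)) (kind x) (s x) (lst (js x)) (j x)
    then atom_num (length (lst (t' x))) (kind x) (s x) (js x) (j x)
    else npair 3 (atom_num (length (lst (t' x))) (kind x) (s x) (js x) (j x))).
  - intros x. unfold t'. rewrite lst_list_num.
    rewrite decide_atom_correct by apply clean_dom.
    rewrite <- atom_num_correct. unfold literal. now destruct (holds _).
  - assert (computable (fun x => atom_num (length (lst (t' x))) (kind x) (s x) (js x) (j x)))
      by (unfold atom_num; comp).
    apply computable_if; [now apply decidable_decide_atom|comp|comp].
Qed.
#[local] Hint Resolve computable_clean computable_fit computable_literal : comp.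

Lemma computable_step_entry f g h k :
  computable f -> computable g -> computable h -> computable k ->
  computable (fun x => step_entry (f x) (g x) (h x) (k x)).
Proof.
  intros Hf Hg Hh Hk. unfold step_entry.
  pose (u := fun x => list_num (clean (lst (psnd (k x))))).
  assert (Hu : computable u) by (unfold u; comp).
  apply computable_ext with (fun x => if pfst (k x) =? 0
    then npair 0 (wrap_num (f x) 2 (g x) (h x) (u x) (length (lst (g x))))
    else npair (length (lst (u x))) (wrap_num (f x) 3 (g x) (h x) (u x)
      (length (lst (g x)) + length (lst (u x))))); [|comp].
  intros x. unfold u. cbv zeta. now rewrite lst_list_num.
Qed.

Lemma computable_back_entry f g h i k :
  computable f -> computable g -> computable h -> computable i -> computable k ->
  computable (fun x => back_entry (f x) (g x) (h x) (i x) (k x)).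
Proof.
  intros Hf Hg Hh Hi Hk. unfold back_entry.
  pose (d := fun x => list_num (fit (lst (i x)) (lst (k x)))).
  assert (Hd : computable d) by (unfold d; comp).
  apply computable_ext with (fun x => npair 0
    (scott_num (f x) (list_num (lst (g x) ++ lst (d x))) (h x))); [|comp].
  intros x. unfold d. now rewrite lst_list_num.
Qed.
#[local] Hint Resolve computable_step_entry computable_back_entry : comp.

Lemma computable_enumerator : computable (fun x => enumerator (pfst x) (psnd x)).
Proof. unfold enumerator, literal_entry, forth_entry, limit_entry. cbv zeta. comp. Qed.

End Back_and_forth.

(** * Scott formulas determine types *)

Lemma step_exponent_correct c : step_exponent (2 ^ 2 ^ c) = c.
Proof.
  unfold step_exponent.
  destruct (bfind_spec (fun c' => 2 ^ 2 ^ c =? 2 ^ 2 ^ c') (2 ^ 2 ^ c) c) as [_ H].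
  - pose proof (Nat.pow_gt_lin_r 2 c). pose proof (Nat.pow_gt_lin_r 2 (2 ^ c)). lia.
  - apply Nat.eqb_refl.
  - apply Nat.eqb_eq in H. symmetry. now apply pow2_inj, pow2_inj.
Qed.

Lemma lim_exponent_step c : lim_exponent (2 ^ 2 ^ c) = 2 ^ 2 ^ c.
Proof.
  apply bfind_none. intros e _. apply Bool.orb_false_iff. split; apply Nat.eqb_neq.
  - apply pow2_neq_lim.
  - intros H. apply pow2_inj in H. now apply pow2_neq_lim in H.
Qed.

Lemma lim_exponent_correct e b : b = 3 * 5 ^ e \/ b = 2 ^ (3 * 5 ^ e) ->
  lim_exponent b = e /\ e < b.
Proof.
  intros Hb.
  assert (He : e < b).
  { pose proof (Nat.pow_gt_lin_r 5 e). destruct Hb as [->| ->]; [lia|].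
    pose proof (Nat.pow_gt_lin_r 2 (3 * 5 ^ e)). lia. }
  split; [|exact He]. unfold lim_exponent.
  destruct (bfind_spec (fun e' => (b =? 3 * 5 ^ e') || (b =? 2 ^ (3 * 5 ^ e')))%bool b e)
    as [_ H]; [exact He| |].
  - apply Bool.orb_true_iff. rewrite !Nat.eqb_eq. exact Hb.
  - apply Bool.orb_true_iff in H. rewrite !Nat.eqb_eq in H. symmetry.
    set (e' := bfind _ _) in *. clearbody e'.
    destruct Hb as [->| ->], H as [H|H].
    + now apply lim_num_inj.
    + symmetry in H. now apply pow2_neq_lim in H.
    + now apply pow2_neq_lim in H.
    + now apply lim_num_inj, pow2_inj.
Qed.

Section Scott_formulas.
Context {V : vocabulary} (A : structure V).
Variable tau : nat.
Hypothesis tau_spec : forall e p s, (forall k, phi e k (s k)) ->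
  forall m, W (range_num tau e p) m <-> exists k, m = enumerator A p (s k).

Notation scott := (fun t b => scott_num tau (list_num t) b).

Lemma scott_num_small t b : b = 2 \/ b = 4 -> scott_num tau t b =
  npair 1 (npair b (npair (length (lst t)) (range_num tau id_num (param tau 0 t)))).
Proof. intros [->| ->]; reflexivity. Qed.

Lemma scott_num_step t c : c <> 0 -> c <> 1 -> scott_num tau t (2 ^ 2 ^ c) =
  npair 1 (npair (2 ^ 2 ^ c) (npair (length (lst t))
    (range_num tau id_num (param tau 1 (npair t c))))).
Proof.
  intros H0 H1. unfold scott_num, scott_set_num.
  assert (Hb : 16 <= 2 ^ 2 ^ c).
  { apply (Nat.pow_le_mono_r 2 (2 ^ 2)); [easy|]. apply Nat.pow_le_mono_r; lia. }
  rewrite lim_exponent_step, step_exponent_correct, Nat.ltb_irrefl.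
  set (b := 2 ^ 2 ^ c) in *. clearbody b.
  (* The tests of [b] against 1, 2 and 4 compute once [b] is seen to be a 16-fold successor. *)
  do 16 (destruct b as [|b]; [lia|]). reflexivity.
Qed.

Lemma scott_num_lim t e b : b = 3 * 5 ^ e \/ b = 2 ^ (3 * 5 ^ e) -> scott_num tau t b =
  npair 1 (npair b (npair (length (lst t)) (range_num tau e (param tau 4 t)))).
Proof.
  intros H. destruct (lim_exponent_correct e b H) as [E He].
  unfold scott_num, scott_set_num. rewrite E. apply Nat.ltb_lt in He. rewrite He.
  assert (Hb : b <> 1 /\ b <> 2 /\ b <> 4).
  { pose proof (Nat.pow_nonzero 5 e). destruct H as [->| ->]; [lia|].
    assert (2 ^ 3 <= 2 ^ (3 * 5 ^ e)) by (apply Nat.pow_le_mono_r; lia).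
    change (2 ^ 3) with 8 in *. lia. }
  destruct Hb as (H1 & H2 & H4).
  apply Nat.eqb_neq in H1, H2, H4. now rewrite H1, H2, H4.
Qed.

(** Equality of types up to the levels affordable at [al]. *)
Definition agree (al : ord) (xs ys : list nat) : Prop :=
  forall s be f, infinitary V s be (length xs) f -> ole (cost be) al ->
    (sat A xs f <-> sat A ys f).

Record scott_formula (b : nat) (al : ord) (t : list nat) (f : form) : Prop := {
  scott_index : index_of V Pi b (length t) f (scott t b);
  scott_sat : sat A t f;
  scott_agree : forall ys, length ys = length t -> Forall (dom A) ys -> sat A ys f ->
    (olt Ozero al -> lit_agree A t ys) /\ agree al t ys }.

Lemma enumerator_param kind rest v : enumerator A (param tau kind rest) v =
  if kind =? 0 then literal_entry A rest v
  else if kind =? 1 then step_entry A tau (pfst rest) (psnd rest) v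
  else if kind =? 2 then
    forth_entry tau (pfst rest) (pfst (psnd rest)) (psnd (psnd rest))
  else if kind =? 3 then
    back_entry A tau (pfst rest) (pfst (psnd rest)) (psnd (psnd rest)) v
  else limit_entry tau rest v.
Proof. unfold enumerator, param. pairs. reflexivity. Qed.

Lemma literal_enumerator t v : enumerator A (param tau 0 t) v = literal_entry A t v.
Proof. apply enumerator_param. Qed.

Lemma step_enumerator t c v :
  enumerator A (param tau 1 (npair t c)) v = step_entry A tau t c v.
Proof. rewrite enumerator_param. pairs. reflexivity. Qed.

Lemma forth_enumerator t c d v :
  enumerator A (param tau 2 (npair t (npair c d))) v = forth_entry tau t c d.
Proof. rewrite enumerator_param. pairs. reflexivity. Qed.

Lemma back_enumerator t c d v :
  enumerator A (param tau 3 (npair t (npair c d))) v = back_entry A tau t c d v.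
Proof. rewrite enumerator_param. pairs. reflexivity. Qed.

Lemma limit_enumerator t v : enumerator A (param tau 4 t) v = limit_entry tau t v.
Proof. apply enumerator_param. Qed.

Lemma enumerated e p s (K I : nat -> nat) : (forall k, phi e k (s k)) ->
  (forall k, enumerator A p (s k) = npair (K k) (I k)) ->
  forall m, W (range_num tau e p) m <-> exists k, m = npair (K k) (I k).
Proof.
  intros Hs HE m. rewrite (tau_spec _ _ _ Hs). split; intros [k ->]; exists k; auto.
Qed.

Lemma wrap_forth t c d f : c <> 0 ->
  index_of V Pi c (length t + length d) f (scott (t ++ d) c) ->
  exists g, index_of V Sigma (2 ^ c) (length t) g
      (wrap_num tau 2 (list_num t) c (list_num d) (length t)) /\
    forall v, sat A v g <-> exists w, length w = length d /\ Forall (dom A) w /\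
      sat A (v ++ w) f.
Proof.
  intros Hc Hf.
  destruct (index_Disj_range A (2 ^ c) (length t) (range_num tau id_num
     (param tau 2 (npair (list_num t) (npair c (list_num d)))))
     (fun _ => length d) (fun _ => scott (t ++ d) c) (fun _ => c) (fun _ => f)) as (g & Hg & Hs).
  - intros H. now apply (pow2_inj c 0) in H.
  - apply enumerated with (s := fun k => k); [exact phi_id|]. intros k.
    rewrite forth_enumerator. unfold forth_entry. rewrite !lst_list_num. reflexivity.
  - intros _. now apply ltO_succ.
  - intros _. exact Hf.
  - exists g. split; [exact Hg|]. intros v. rewrite Hs. split.
    + intros (_ & w & H). eauto.
    + intros (w & H). exists 0. eauto.
Qed.

Lemma fit_length d v : length (fit A d v) = length d.
Proof.
  unfold fit. destruct (forallb _ v && _)%bool eqn:E; [|reflexivity].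
  apply Bool.andb_true_iff in E as [_ E]. now apply Nat.eqb_eq.
Qed.

Lemma fit_dom d v : Forall (dom A) d -> Forall (dom A) (fit A d v).
Proof.
  intros Hd. unfold fit. destruct (forallb _ v) eqn:E; [|exact Hd].
  destruct (_ =? _); [|exact Hd]. now apply forallb_dom.
Qed.

Lemma fit_id d v : length v = length d -> Forall (dom A) v -> fit A d v = v.
Proof.
  intros Hl Hv. unfold fit. apply forallb_dom in Hv.
  apply Nat.eqb_eq in Hl. now rewrite Hv, Hl.
Qed.

(** The formula [f d'] is needed for every tuple [d'] as long as [d], although only [d] occurs in
    the index. *)
Lemma wrap_back t c d (f : list nat -> form) : c <> 0 -> Forall (dom A) d ->
  (forall d', Forall (dom A) d' -> length d' = length d ->
     index_of V Pi c (length t + length d) (f d') (scott (t ++ d') c)) ->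
  exists g, index_of V Sigma (2 ^ c) (length t + length d) g
      (wrap_num tau 3 (list_num t) c (list_num d) (length t + length d)) /\
    forall v, sat A v g <-> exists d', length d' = length d /\ Forall (dom A) d' /\
      sat A v (f d').
Proof.
  intros Hc Hd Hf.
  destruct (index_Disj_range A (2 ^ c) (length t + length d) (range_num tau id_num
     (param tau 3 (npair (list_num t) (npair c (list_num d)))))
     (fun _ => 0) (fun k => scott (t ++ fit A d (lst k)) c) (fun _ => c)
     (fun k => f (fit A d (lst k)))) as (g & Hg & Hs).
  - intros H. now apply (pow2_inj c 0) in H.
  - apply enumerated with (s := fun k => k); [exact phi_id|]. intros k.
    rewrite back_enumerator. unfold back_entry. rewrite !lst_list_num. reflexivity.
  - intros _. now apply ltO_succ.
  - intros k. rewrite Nat.add_0_r. apply Hf; [now apply fit_dom|apply fit_length].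
  - exists g. split; [exact Hg|]. intros v. rewrite Hs. split.
    + intros (k & w & Hw & _ & H). exists (fit A d (lst k)).
      destruct w; [|discriminate]. rewrite app_nil_r in H.
      auto using fit_length, fit_dom.
    + intros (d' & Hl & Hd' & H). exists (list_num d'), [].
      rewrite lst_list_num, fit_id, app_nil_r by easy. auto.
Qed.

Lemma cost_not_le_small be : ~ ole (cost be) (osucc (osucc Ozero)).
Proof.
  intros H. apply (olt_irrefl (osucc (osucc Ozero))).
  eapply olt_ole_trans; [apply olt_osucc|]. eapply ole_trans; [apply (cost_ge3 be)|exact H].
Qed.

Lemma scott_formula_zero t : Forall (dom A) t -> scott_formula 1 Ozero t (QF QTrue).
Proof.
  intros Ht. split.
  - constructor. exact I.
  - exact I.
  - intros ys _ _ _. split; [easy|]. intros s be f _ H.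
    destruct (cost_not_le_small be). eapply ole_trans; [exact H|exact I].
Qed.

(** Here [agree] is vacuous, as [al] is below every cost. *)
Lemma scott_formula_literals t b al : b = 2 \/ b = 4 -> ole al (osucc (osucc Ozero)) ->
  Forall (dom A) t -> exists f, scott_formula b al t f.
Proof.
  intros Hb Hal Ht.
  pose (lit := fun k => literal A (clean A t) (pfst k) (pfst (psnd k))
     (lst (pfst (psnd (psnd k)))) (psnd (psnd (psnd k)))).
  destruct (index_Conj_range A b (length t) (range_num tau id_num
     (param tau 0 (list_num t)))
     (fun _ => 0) (fun k => npair 2 (qform_num (lit k))) (fun _ => 1)
     (fun k => QF (lit k))) as (g & Hg & Hs).
  - lia.
  - apply enumerated with (s := fun k => k); [exact phi_id|]. intros k.
    rewrite literal_enumerator. unfold literal_entry, lit. rewrite lst_list_num. reflexivity.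
  - intros _. assert (H2 : ltO 1 2) by now apply (ltO_succ 1).
    destruct Hb as [->| ->]; [exact H2|]. now apply (ltO_succ_trans 1 2).
  - intros k. rewrite Nat.add_0_r. constructor. unfold lit.
    rewrite (clean_id A t Ht). apply literal_wf.
  - unfold lit in Hs. rewrite (clean_id A t Ht) in Hs.
    exists g. split.
    + cbv beta. rewrite scott_num_small, lst_list_num by exact Hb. exact Hg.
    + apply Hs. intros k w Hw _. destruct w; [|discriminate]. rewrite app_nil_r.
      apply literal_true.
    + intros ys Hl Hd H. split.
      * intros _. apply literals_agree. intros kind s js j. rewrite Hs in H.
        specialize (H (npair kind (npair s (npair (list_num js) j))) [] eq_refl (Forall_nil _)).
        rewrite app_nil_r in H. revert H. pairs. now rewrite lst_list_num.
      * intros s be f _ Hc. destruct (cost_not_le_small be). eapply ole_trans; eauto.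
Qed.

(** A quantifier block of length [k] is matched by extending both tuples by [k] entries at once;
    quantifier-free formulas are settled by extending [xs] with the values of all subterms. *)
Lemma agree_step al xs ys : olt Ozero al -> length ys = length xs ->
  Forall (dom A) xs -> Forall (dom A) ys ->
  (forall u, Forall (dom A) u -> exists v, length v = length u /\ Forall (dom A) v /\
     lit_agree A (xs ++ u) (ys ++ v) /\ agree al (xs ++ u) (ys ++ v)) ->
  (forall v, Forall (dom A) v -> exists u, length u = length v /\ Forall (dom A) u /\
     agree al (xs ++ u) (ys ++ v)) ->
  agree (osucc (osucc al)) xs ys.
Proof.
  intros Hal Hl Hx Hy forth back s be f Hf Hc.
  assert (Hlow : forall ga, olt ga be -> ole (cost ga) al).
  { intros ga Hga. apply (proj1 (osucc_ole_osucc _ _)), (proj1 (osucc_ole_osucc _ _)).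
    eapply ole_trans; [apply cost_step, Hga|exact Hc]. }
  remember (length xs) as n eqn:En. destruct Hf as [s be n q Hq Hwf|be n J k F ga Hpos Hga HF|be n J k F ga Hpos Hga HF]; subst n.
  - destruct (forth (qsubvalues A xs q)) as (v & Hv & Hd & HL & _).
    { now apply qsubvalues_dom. }
    simpl. eapply qsat_lit_agree; eauto. apply incl_refl.
  - assert (Hsub : forall i u v, J i -> length u = k i -> agree al (xs ++ u) (ys ++ v) ->
      (sat A (xs ++ u) (F i) <-> sat A (ys ++ v) (F i))).
    { intros i u v Hi Hu H. eapply H; [rewrite length_app, Hu; eauto|auto]. }
    simpl. split; intros (i & Hi & w & Hw & Hd & H).
    + destruct (forth w Hd) as (v & Hv & Hdv & _ & Ha). exists i. split; [exact Hi|].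
      exists v. split; [congruence|]. split; [exact Hdv|]. eapply Hsub; eauto.
    + destruct (back w Hd) as (u & Hu & Hdu & Ha). exists i. split; [exact Hi|].
      exists u. split; [congruence|]. split; [exact Hdu|]. eapply Hsub; eauto. congruence.
  - assert (Hsub : forall i u v, J i -> length u = k i -> agree al (xs ++ u) (ys ++ v) ->
      (sat A (xs ++ u) (F i) <-> sat A (ys ++ v) (F i))).
    { intros i u v Hi Hu H. eapply H; [rewrite length_app, Hu; eauto|auto]. }
    simpl. split; intros H i Hi w Hw Hd.
    + destruct (back w Hd) as (u & Hu & Hdu & Ha).
      apply (Hsub i u w Hi); auto; [congruence|]. apply H; congruence || auto.
    + destruct (forth w Hd) as (v & Hv & Hdv & _ & Ha).
      apply (Hsub i w v Hi); auto. apply H; congruence || auto.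
Qed.

(** A disjunction whose cost exceeds every [al n] is treated one disjunct at a time: each disjunct
    alone is a formula of cost below the limit.  The same works one level above the limit, since
    the cost of a disjunct stays two levels below that of the disjunction. *)
Lemma agree_limit (al : nat -> ord) bl xs ys :
  (forall n, olt (al n) (al (S n))) -> ole bl (osucc (Osup al)) ->
  (forall n, agree (al n) xs ys) -> agree bl xs ys.
Proof.
  intros Hlt Hbl H s be f Hf Hc.
  assert (Hlow : forall ga, olt ga be -> exists n, ole (cost (osucc ga)) (al n)).
  { intros ga Hga.
    assert (Hm : olt (cost ga) (Osup al)).
    { apply osucc_ole. apply (proj1 (osucc_ole_osucc _ _)).
      eapply ole_trans; [apply cost_step, Hga|]. eapply ole_trans; eauto. }
    destruct Hm as [m Hm].
    (* [m] pays for the subformula, two more levels for its quantifiers. *)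
    exists (S (S m)).
    change (cost (osucc ga)) with (osucc (osucc (cost ga))). apply osucc_ole.
    eapply ole_olt_trans; [|apply Hlt]. apply osucc_ole.
    eapply ole_olt_trans; [exact Hm|apply Hlt]. }
  remember (length xs) as n eqn:En. destruct Hf as [s be n q Hq Hwf|be n J k F ga Hpos Hga HF|be n J k F ga Hpos Hga HF]; subst n.
  (* [cost Ozero] is 3, which is at most [al 3] as the sequence increases strictly. *)
  - apply (H 3 s Ozero).
    + constructor; [split; exact I|exact Hwf].
    + change (cost Ozero) with (osucc (osucc (osucc Ozero))).
      repeat (apply osucc_ole; eapply ole_olt_trans; [|apply Hlt]). exact I.
  - assert (Hi : forall i, J i ->
      (sat A xs (Disj (fun j => j = i) k F) <-> sat A ys (Disj (fun j => j = i) k F))).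
    { intros i Hi. destruct (Hlow _ (Hga i Hi)) as [m Hm].
      apply (H m Sigma (osucc (ga i))); [|exact Hm].
      apply infinitary_Disj with ga; [now exists 0| |]; intros ? ->; auto using olt_osucc. }
    simpl in *. split; intros (i & HJ & Hs).
    + destruct (proj1 (Hi i HJ)) as (? & -> & ?); eauto.
    + destruct (proj2 (Hi i HJ)) as (? & -> & ?); eauto.
  - assert (Hi : forall i, J i ->
      (sat A xs (Conj (fun j => j = i) k F) <-> sat A ys (Conj (fun j => j = i) k F))).
    { intros i Hi. destruct (Hlow _ (Hga i Hi)) as [m Hm].
      apply (H m Pi (osucc (ga i))); [|exact Hm].
      apply infinitary_Conj with ga; [now exists 0| |]; intros ? ->; auto using olt_osucc. }
    simpl in *. split; intros Hs i HJ; apply (Hi i HJ); auto; intros ? ->; auto.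
Qed.

Definition has_scott_formulas (b : nat) (al : ord) : Prop :=
  forall t, Forall (dom A) t -> exists f, scott_formula b al t f.

(** The formulas for all extensions of [t] are fixed first, as those inside a kind 3 disjunction
    must be a function of the extension. *)
Lemma scott_formula_step c cl : notation c cl -> c <> 1 ->
  has_scott_formulas c cl -> has_scott_formulas (2 ^ 2 ^ c) (osucc (osucc cl)).
Proof.
  intros Hc Hc1 HP t Ht.
  assert (Hc0 : c <> 0) by (eapply notation_nonzero; eauto).
  destruct (functional_choice (fun t f => Forall (dom A) t -> scott_formula c cl t f))
    as [Phi HPhi].
  { intros t'. destruct (classic (Forall (dom A) t')) as [H|H].
    - destruct (HP t' H). eauto.
    - exists (QF QTrue). easy. }
  pose (u := fun k => clean A (lst (psnd k))).
  assert (Hu : forall k, Forall (dom A) (u k)) by (intros; apply clean_dom).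
  pose (K := fun k => if pfst k =? 0 then 0 else length (u k)).
  pose (I := fun k => if pfst k =? 0
    then wrap_num tau 2 (list_num t) c (list_num (u k)) (length t)
    else wrap_num tau 3 (list_num t) c (list_num (u k)) (length t + length (u k))).
  destruct (functional_choice (fun k f =>
     index_of V Sigma (2 ^ c) (length t + K k) f (I k) /\
     forall v, sat A v f <-> if pfst k =? 0
       then exists w, length w = length (u k) /\ Forall (dom A) w /\
         sat A (v ++ w) (Phi (t ++ u k))
       else exists d, length d = length (u k) /\ Forall (dom A) d /\
         sat A v (Phi (t ++ d)))) as [f Hf].
  { intros k. unfold K, I. destruct (pfst k =? 0).
    - rewrite Nat.add_0_r. apply wrap_forth; [exact Hc0|].
      rewrite <- length_app. apply HPhi. now apply Forall_app.
    - apply wrap_back; auto. intros d' Hd' Hl. rewrite <- Hl, <- length_app.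
      apply HPhi. now apply Forall_app. }
  destruct (index_Conj_range A (2 ^ 2 ^ c) (length t)
    (range_num tau id_num (param tau 1 (npair (list_num t) c))) K I
    (fun _ => 2 ^ c) f) as (g & Hg & Hs).
  - intros H. apply (pow2_inj (2 ^ c) 0) in H. now apply Nat.pow_nonzero in H.
  - apply enumerated with (s := fun k => k); [exact phi_id|]. intros k.
    rewrite step_enumerator. unfold step_entry, K, I, u. rewrite lst_list_num.
    destruct (pfst k =? 0); reflexivity.
  - intros _. apply ltO_succ. now apply Nat.pow_nonzero.
  - intros k. apply Hf.
  - assert (Hlen : forall x y z w : list nat, length y = length x ->
      length w = length z -> length (y ++ w) = length (x ++ z))
      by (intros; rewrite !length_app; congruence).
    exists g. split.
    + cbv beta. rewrite scott_num_step, lst_list_num by assumption. exact Hg.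
    + apply Hs. intros k w Hw Hd. apply Hf. unfold K in Hw. destruct (pfst k =? 0).
      * destruct w; [|discriminate]. rewrite app_nil_r. exists (u k).
        repeat split; auto. apply HPhi. now apply Forall_app.
      * exists w. repeat split; auto. apply HPhi. now apply Forall_app.
    + intros ys Hl Hys Hg'. rewrite Hs in Hg'.
      assert (forth : forall x, Forall (dom A) x -> exists y, length y = length x /\
        Forall (dom A) y /\ lit_agree A (t ++ x) (ys ++ y) /\ agree cl (t ++ x) (ys ++ y)).
      { intros x Hx. specialize (Hg' (npair 0 (list_num x)) []).
        unfold K in Hg'. rewrite pfst_npair in Hg'. simpl in Hg'.
        specialize (Hg' eq_refl (Forall_nil _)). apply Hf in Hg'.
        rewrite pfst_npair, app_nil_r in Hg'. simpl in Hg'.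
        unfold u in Hg'. rewrite psnd_npair, lst_list_num, clean_id in Hg' by exact Hx.
        destruct Hg' as (y & Hy & Hdy & H). exists y. split; [exact Hy|].
        split; [exact Hdy|].
        apply (scott_agree _ _ _ _ (HPhi _ (proj2 (Forall_app _ _ _) (conj Ht Hx)))) in H;
          [|auto|now apply Forall_app].
        split; [|apply H]. apply H. eapply notation_pos; eauto. }
      split.
      * intros _. destruct (forth [] (Forall_nil _)) as (y & Hy & _ & HL & _).
        destruct y; [|discriminate]. now rewrite !app_nil_r in HL.
      * apply agree_step; auto; [eapply notation_pos; eauto|].
        intros y Hy. specialize (Hg' (npair 1 (list_num y)) y).
        assert (Eu : u (npair 1 (list_num y)) = y)
          by (unfold u; rewrite psnd_npair, lst_list_num; now apply clean_id).
        unfold K in Hg'. rewrite pfst_npair, Eu in Hg'.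
        specialize (Hg' eq_refl Hy). apply Hf in Hg'.
        rewrite pfst_npair, Eu in Hg'. simpl in Hg'.
        destruct Hg' as (x & Hx & Hdx & H). exists x. split; [exact Hx|].
        split; [exact Hdx|].
        apply (scott_agree _ _ _ _ (HPhi _ (proj2 (Forall_app _ _ _) (conj Ht Hdx)))) in H;
          [apply H|auto|now apply Forall_app].
Qed.

Lemma scott_formula_limit e s al b bl :
  (forall n, phi e n (s n)) -> (forall n, ltO (s n) (s (S n))) ->
  (forall n, notation (s n) (al n)) ->
  b = 3 * 5 ^ e \/ b = 2 ^ (3 * 5 ^ e) -> ole bl (osucc (Osup al)) ->
  (forall n, has_scott_formulas (s n) (al n)) -> has_scott_formulas b bl.
Proof.
  intros Hs Hlt Hn Hb Hbl HP t Ht.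
  assert (Hal : forall n, olt (al n) (al (S n)))
    by (intros n; eapply ltO_olt; eauto).
  destruct (functional_choice (fun n f => scott_formula (s n) (al n) t f))
    as [Phi HPhi]; [intros n; now apply HP|].
  destruct (functional_choice (fun n f =>
     index_of V Sigma (2 ^ s n) (length t + 0) f (wrap_num tau 2 (list_num t) (s n) 0 (length t)) /\
     forall v, sat A v f <-> sat A v (Phi n))) as [f Hf].
  { intros n. destruct (wrap_forth t (s n) [] (Phi n)) as (g & Hg & Hgs).
    - eapply notation_nonzero; eauto.
    - cbn [length]. rewrite Nat.add_0_r, app_nil_r. apply HPhi.
    - exists g. rewrite Nat.add_0_r. split; [exact Hg|]. intros v. rewrite Hgs. split.
      + intros (w & Hw & _ & H). destruct w; [|discriminate]. now rewrite app_nil_r in H.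
      + intros H. exists []. rewrite app_nil_r. auto. }
  destruct (index_Conj_range A b (length t) (range_num tau e (param tau 4 (list_num t)))
    (fun _ => 0) (fun n => wrap_num tau 2 (list_num t) (s n) 0 (length t))
    (fun n => 2 ^ s n) f) as (g & Hg & Hgs).
  - pose proof (Nat.pow_nonzero 5 e). destruct Hb as [->| ->]; [lia|].
    intros E. apply (pow2_inj _ 0) in E. lia.
  - apply enumerated with s; [exact Hs|]. intros k.
    rewrite limit_enumerator. unfold limit_entry. rewrite lst_list_num. reflexivity.
  - intros n. assert (H : ltO (2 ^ s n) (3 * 5 ^ e)) by (eapply ltO_succ_lim; eauto).
    destruct Hb as [->| ->]; [exact H|now apply ltO_succ_trans].
  - intros n. apply Hf.
  - exists g. split.
    + cbv beta. rewrite (scott_num_lim _ _ _ Hb), lst_list_num. exact Hg.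
    + apply Hgs. intros n w Hw _. destruct w; [|discriminate]. rewrite app_nil_r.
      apply Hf, HPhi.
    + intros ys Hl Hd H. rewrite Hgs in H.
      assert (HA : forall n, (olt Ozero (al n) -> lit_agree A t ys) /\ agree (al n) t ys).
      { intros n. apply (HPhi n); auto. specialize (H n [] eq_refl (Forall_nil _)).
        rewrite app_nil_r in H. now apply Hf. }
      split.
      * intros _. apply (HA 1). eapply ole_olt_trans; [|apply Hal]. exact I.
      * apply agree_limit with al; auto. intros n. apply HA.
Qed.

(** A step moves up two levels at once, so the induction carries a notation and its successor. *)
Lemma scott_formulas b bl : notation b bl -> has_scott_formulas b bl.
Proof.
  intros H.
  enough (has_scott_formulas b bl /\ has_scott_formulas (2 ^ b) (osucc bl)) by easy.
  induction H as [|a al Ha [IH1 IH2]|e s al Hs Hlt Hn IH].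
  - split.
    + intros t Ht. eexists. now apply scott_formula_zero.
    + intros t Ht. apply scott_formula_literals; auto.
      apply osucc_ole_osucc. exact I.
  - split; [exact IH2|]. destruct (Nat.eq_dec a 1) as [->|Ha1].
    + apply notation_1 in Ha as ->. intros t Ht.
      apply scott_formula_literals; auto using ole_refl.
    + now apply scott_formula_step.
  - assert (H : forall n, has_scott_formulas (s n) (al n)) by (intros n; apply IH).
    split; eapply scott_formula_limit; eauto using ole_refl.
    apply olt_ole, olt_osucc.
Qed.
End Scott_formulas.

(** * Scott ranks *)

Lemma exact_notation l om d : is_omega1ck om -> ole l om -> olt d l ->
  exists b bl, notation b bl /\ oeq bl d.
Proof.
  intros [_ Hom] Hl Hd.
  destruct (classic (computable_ordinal d)) as [Hc|Hc].
  - destruct (computable_ordinal_notation d Hc) as (n & nl & Hn & Hle).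
    eapply notation_below; eauto.
  - destruct (olt_irrefl d). eapply olt_ole_trans; [exact Hd|].
    eapply ole_trans; [exact Hl|now apply Hom].
Qed.

(** If [P] holds below [l], then [Q] need not hold at the same level: any level still below [l]
    contradicts the minimality of [l] for [Q]. *)
Lemma least_iff (P Q : ord -> Prop) l :
  (forall a, Q a -> P a) -> (P l -> Q l) ->
  (forall b, olt b l -> P b -> exists c, olt c l /\ Q c) ->
  (least P l <-> least Q l).
Proof.
  intros HQP HPQ Hlow. split; intros [Hl Hmin]; split; auto.
  intros b Hb. destruct (ole_or_olt l b) as [H|H]; [exact H|].
  destruct (Hlow b H Hb) as (c & Hc & HQ). destruct (olt_irrefl c).
  eapply olt_ole_trans; [exact Hc|auto].
Qed.

Section Ranks.
Context {V : vocabulary} (A : structure V).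

Lemma orbits_Sigma_in_mono al be :
  ole al be -> orbits_Sigma_in A al -> orbits_Sigma_in A be.
Proof.
  intros Hle H xs Hxs. destruct (H xs Hxs) as (f & Hf & Hd).
  destruct (infinitary_lift A al be _ f Hle Hf) as (g & Hg & Hs).
  exists g. split; [exact Hg|]. intros ys Hl Hys. rewrite Hs. auto.
Qed.

Lemma orbits_Sigma_c_in al : orbits_Sigma_c A al -> orbits_Sigma_in A al.
Proof.
  intros H xs Hxs.
  destruct (H xs Hxs) as (be & f & Hle & (a & al' & i & Ha & Heq & Hi) & Hd).
  destruct (infinitary_lift A al' al (length xs) f) as (g & Hg & Hs).
  - eapply ole_trans; [apply Heq|exact Hle].
  - eapply index_infinitary; eauto.
  - exists g. split; [exact Hg|]. intros ys Hl Hys. rewrite Hs. auto.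
Qed.

(** An orbit is a minimal invariant set, so a disjunct true of [xs] already defines it. *)
Lemma orbit_disjunct al f xs : Forall (dom A) xs -> olt Ozero al ->
  infinitary V Sigma al (length xs) f -> defines_orbit A f xs ->
  exists be w g, olt be al /\ Forall (dom A) w /\
    infinitary V Pi be (length xs + length w) g /\ sat A (xs ++ w) g /\
    forall ys w', length ys = length xs -> Forall (dom A) ys ->
      length w' = length w -> Forall (dom A) w' -> sat A (ys ++ w') g ->
      same_orbit A xs ys.
Proof.
  intros Hxs Hal Hf Hd.
  assert (Hsat : sat A xs f) by (apply Hd; auto using same_orbit_refl).
  remember Sigma as s eqn:Es. remember (length xs) as n eqn:En.
  destruct Hf as [s al n q Ha Hq|al n J k F be Ha Hl HF|]; [| |discriminate].
  - destruct (olt_irrefl al). eapply ole_olt_trans; [apply Ha|exact Hal].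
  - subst n. destruct Hsat as (i & Hi & w & Hw & Hdw & Hs).
    exists (be i), w, (F i). rewrite Hw. repeat split; auto.
    intros ys w' Hl' Hys Hw' Hdw' H. apply Hd; auto. exists i. eauto 6.
Qed.

Context (HV : computable_vocabulary V) (HA : computable_structure A).

(** The Scott formula of [xs ++ w], with [w] quantified, implies that [g] has witnesses. *)
Lemma orbit_Sigma_c b bl be xs w g : notation b bl -> ole (cost be) bl ->
  Forall (dom A) xs -> Forall (dom A) w ->
  infinitary V Pi be (length xs + length w) g -> sat A (xs ++ w) g ->
  (forall ys w', length ys = length xs -> Forall (dom A) ys ->
      length w' = length w -> Forall (dom A) w' -> sat A (ys ++ w') g ->
      same_orbit A xs ys) ->
  exists f, computable_infinitary V Sigma (osucc bl) (length xs) f /\ defines_orbit A f xs.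
Proof.
  intros Hb Hc Hxs Hw Hg Hsat Horb.
  destruct (range_template (enumerator A) (computable_enumerator A HV HA)) as [T HT].
  assert (Hxw : Forall (dom A) (xs ++ w)) by now apply Forall_app.
  destruct (scott_formulas A _ HT b bl Hb _ Hxw) as [phi [Hi Hphi Hagree]].
  destruct (wrap_forth A _ HT xs b w phi) as (f & Hf & Hfs).
  { eapply notation_nonzero; eauto. }
  { now rewrite <- length_app. }
  assert (H2b : notation (2 ^ b) (osucc bl)) by now constructor.
  exists f. split.
  { exists (2 ^ b), (osucc bl). eexists. split; [exact H2b|]. split; [|exact Hf].
    split; apply ole_refl. }
  intros ys Hl Hys. split.
  - intros H. apply Hfs in H as (w' & Hw' & Hdw' & H).
    apply (Horb ys w'); auto.
    destruct (Hagree (ys ++ w')) as [_ Ha]; auto.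
    + rewrite !length_app. congruence.
    + now apply Forall_app.
    + rewrite <- length_app in Hg. now apply (Ha _ _ _ Hg Hc).
  - intros H. pose proof (index_infinitary _ _ _ _ _ _ Hf _ H2b) as Hfin.
    apply (sat_orbit A _ _ _ _ _ Hfin Hxs H). apply Hfs. eauto.
Qed.

Lemma orbits_Sigma_c_cost be b bl : notation b bl -> ole (cost be) bl ->
  orbits_Sigma_in A be -> orbits_Sigma_c A (osucc bl).
Proof.
  intros Hb Hc H xs Hxs.
  apply (orbits_Sigma_in_mono be (osucc be)) in H; [|apply olt_ole, olt_osucc].
  destruct (H xs Hxs) as (f & Hf & Hd).
  destruct (orbit_disjunct (osucc be) f xs Hxs) as (ga & w & g & Hga & Hw & Hg & Hs & Ho);
    auto; [now exists 0|].
  destruct (orbit_Sigma_c b bl ga xs w g) as (f' & Hf' & Hd'); auto.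
  - eapply ole_trans; [|exact Hc]. apply cost_mono. now apply olt_osucc_iff.
  - exists (osucc bl), f'. auto using ole_refl.
Qed.

Lemma orbits_Sigma_c_limit l : olimit l ->
  (forall d, olt d l -> exists b bl, notation b bl /\ oeq bl d) ->
  orbits_Sigma_in A l -> orbits_Sigma_c A l.
Proof.
  intros Hl Hn H xs Hxs. destruct (H xs Hxs) as (f & Hf & Hd).
  destruct (orbit_disjunct l f xs Hxs (proj1 Hl)) as (ga & w & g & Hga & Hw & Hg & Hs & Ho);
    auto.
  assert (Hcl : olt (cost ga) l) by now apply cost_limit.
  destruct (Hn _ Hcl) as (b & bl & Hb & Hle & Hge).
  destruct (orbit_Sigma_c b bl ga xs w g) as (f' & Hf' & Hd'); auto.
  exists (osucc bl), f'. split; [|auto]. apply osucc_ole. eapply ole_olt_trans; eauto.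
Qed.

Lemma orbits_Sigma_c_succ_limit l b bl : olimit l -> notation b bl -> oeq bl l ->
  orbits_Sigma_in A (osucc l) -> orbits_Sigma_c A (osucc l).
Proof.
  intros Hl Hb [Hle Hge] H xs Hxs. destruct (H xs Hxs) as (f & Hf & Hd).
  destruct (orbit_disjunct (osucc l) f xs Hxs) as (ga & w & g & Hga & Hw & Hg & Hs & Ho);
    auto; [now exists 0|].
  destruct (orbit_Sigma_c b bl ga xs w g) as (f' & Hf' & Hd'); auto.
  - eapply ole_trans; [|exact Hge]. eapply ole_trans; [|now apply cost_limit_self].
    apply cost_mono. now apply olt_osucc_iff.
  - exists (osucc bl), f'. split; [now apply osucc_ole_osucc|auto].
Qed.

Lemma infinitary_zero s be n f : ole be Ozero -> infinitary V s be n f ->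
  exists q, f = QF q /\ qform_wf V n q.
Proof.
  intros Hbe H. destruct H as [s al n q Ha Hq|al n J k F ga Ha Hl HF|al n J k F ga Ha Hl HF].
  - eauto.
  - destruct (olt_irrefl Ozero). eapply olt_ole_trans; eauto.
  - destruct (olt_irrefl Ozero). eapply olt_ole_trans; eauto.
Qed.

Lemma orbits_Sigma_c_zero : orbits_Sigma_in A Ozero -> orbits_Sigma_c A Ozero.
Proof.
  intros H xs Hxs. destruct (H xs Hxs) as (f & Hf & Hd).
  destruct (infinitary_zero _ _ _ _ (ole_refl _) Hf) as (q & -> & Hq).
  exists Ozero, (QF q). split; [apply ole_refl|]. split; [|exact Hd].
  exists 1, Ozero. eexists. repeat split; constructor; exact Hq.
Qed.

Lemma orbits_Sigma_c_one : orbits_Sigma_in A (osucc Ozero) -> orbits_Sigma_c A (osucc Ozero).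
Proof.
  intros H xs Hxs. destruct (H xs Hxs) as (f & Hf & Hd).
  destruct (orbit_disjunct (osucc Ozero) f xs Hxs) as (ga & w & g & Hga & Hw & Hg & Hs & Ho);
    auto; [now exists 0|].
  apply olt_osucc_iff in Hga.
  destruct (infinitary_zero _ _ _ _ Hga Hg) as (q & -> & Hq).
  destruct (range_template (fun p _ => p)) as [T HT]; [comp|].
  destruct (index_Disj_range A 2 (length xs) (range_num (code_num T) id_num
     (npair (length w) (npair 2 (qform_num q))))
     (fun _ => length w) (fun _ => npair 2 (qform_num q)) (fun _ => 1) (fun _ => QF q))
    as (f' & Hf' & Hs').
  - easy.
  - intros m. apply (HT _ _ (fun k => k)). exact phi_id.
  - intros _. now apply (ltO_succ 1).
  - intros _. now constructor.
  - assert (H2 : notation 2 (osucc Ozero)) by (apply (notation_succ 1); constructor).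
    exists (osucc Ozero), f'. split; [apply ole_refl|]. split.
    { exists 2, (osucc Ozero). eexists. split; [exact H2|]. split; [|exact Hf'].
      split; apply ole_refl. }
    intros ys Hl Hys. split.
    + intros H'. apply Hs' in H' as (_ & w' & Hw' & Hdw' & H'). eapply Ho; eauto.
    + intros H'. pose proof (index_infinitary _ _ _ _ _ _ Hf' _ H2) as Hfin.
      apply (sat_orbit A _ _ _ _ _ Hfin Hxs H'). apply Hs'. exists 0. eauto.
Qed.
End Ranks.

Theorem theorem17 (V : vocabulary) (HV : computable_vocabulary V)
    (A : structure V) (HA : computable_structure A) :
  (forall omega1ck : ord, is_omega1ck omega1ck ->
   forall lambda : ord, olimit lambda -> ole lambda omega1ck ->
     (scott_rank A lambda <-> computably_defined_scott_rank A lambda)) /\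
  (forall lambda : ord, olimit lambda -> computable_ordinal lambda ->
     (scott_rank A (osucc lambda) <->
      computably_defined_scott_rank A (osucc lambda))) /\
  (scott_rank A (osucc Ozero) <->
   computably_defined_scott_rank A (osucc Ozero)).
Proof.
  split; [|split].
  - intros om Hom l Hl Hle.
    pose proof (fun d => exact_notation l om d Hom Hle) as Hn.
    apply least_iff.
    + apply orbits_Sigma_c_in.
    + now apply orbits_Sigma_c_limit.
    + intros be Hbe H.
      destruct (Hn _ (cost_limit be l Hl Hbe)) as (b & bl & Hb & H1 & H2).
      exists (osucc bl). split.
      * apply olimit_succ; [exact Hl|]. eapply ole_olt_trans; [exact H1|].
        now apply cost_limit.
      * now apply orbits_Sigma_c_cost with be b.
  - intros l Hl Hc.
    destruct (computable_ordinal_notation l Hc) as (n & nl & Hnl & Hle).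
    destruct (notation_below n nl Hnl l Hle) as (b & bl & Hb & Heq).
    apply least_iff.
    + apply orbits_Sigma_c_in.
    + now apply orbits_Sigma_c_succ_limit with b bl.
    + intros be Hbe H. exists l. split; [apply olt_osucc|].
      apply (orbits_Sigma_c_limit A HV HA l Hl).
      * intros d Hd. eapply notation_below; [exact Hnl|].
        eapply ole_trans; [apply olt_ole, Hd|exact Hle].
      * apply (orbits_Sigma_in_mono A be l); [|exact H]. now apply olt_osucc_iff.
  - apply least_iff.
    + apply orbits_Sigma_c_in.
    + apply orbits_Sigma_c_one.
    + intros be Hbe H. exists Ozero. split; [apply olt_osucc|].
      apply orbits_Sigma_c_zero. apply (orbits_Sigma_in_mono A be Ozero); [|exact H].
      now apply olt_osucc_iff.
Qed.
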